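(* Let $E_1, E_2$ be Banach spaces, $T>0$, $p\in[1,+\infty]$, and let $B:E_1\to E_2$ be a (possibly nonlinear) compact operator. Let $U$ be a bounded subset of $L^1(0,T;E_1)$ such that $V=B(U)$ is a subset of $L^p(0,T;E_2)$ which is bounded in $L^r(0,T;E_2)$ for some $r>1$. Assume that $$\lim_{h\to 0^+}\|v(\cdot+h)-v\|_{L^p(0,T-h;E_2)}=0 \quad\text{uniformly for } v\in V.$$ Then $V$ is relatively compact in $L^p(0,T;E_2)$, and, if $p=+\infty$, $V$ is relatively compact in $\mathcal{C}([0,T];E_2)$.
   Context: A (nonlinear) operator $B:E_1\to E_2$ is called compact if it maps bounded subsets of $E_1$ to relatively compact subsets of $E_2$ (no continuity, linearity or monotonicity is assumed). For $u\in L^1(0,T;E_1)$, $B(u)$ denotes the function $t\mapsto B(u(t))$, and $B(U)=\{B(u):u\in U\}$. In the case $p=+\infty$, elements of $V$ are identified with their continuous representatives. *)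

(* Defs.v *)
From HB Require Import structures.
From mathcomp Require Import all_boot all_order all_algebra.
From mathcomp Require Import all_classical all_reals all_analysis.
Set Implicit Arguments. Unset Strict Implicit. Unset Printing Implicit Defensive.
Import Order.TTheory GRing.Theory Num.Theory.
Import numFieldNormedType.Exports.
Local Open Scope classical_set_scope.
Local Open Scope ring_scope.

Section Bochner.
Variables (R : realType) (E : normedModType R).

Local Notation mu := (@lebesgue_measure R).

Definition simple_function (g : R -> E) : Prop :=
  finite_set (range g) /\ forall y : E, measurable (g @^-1` [set y]).

Definition strongly_measurable_on (a b : R) (f : R -> E) : Prop :=
  exists g : nat -> R -> E, (forall n, simple_function (g n)) /\
    {ae mu, forall x, x \in `[a, b] -> g n x @[n --> \oo] --> f x}.

Definition norm_on (a b : R) (f : R -> E) : R -> \bar R :=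
  fun x => (if x \in `[a, b] then `|f x| else 0)%:E.

Definition LpnormE (p : \bar R) (a b : R) (f : R -> E) : \bar R :=
  Lnorm mu p (norm_on a b f).

Definition in_Lp (p : \bar R) (a b : R) (f : R -> E) : Prop :=
  strongly_measurable_on a b f /\ (LpnormE p a b f < +oo)%E.

(** relative compactness in L^p(0,T;E) (a metric space): every sequence of V has
    a subsequence converging in L^p(0,T;E) to an element of L^p(0,T;E). *)
Definition rel_compact_Lp (p : \bar R) (T : R) (V : set (R -> E)) : Prop :=
  forall v : nat -> R -> E, (forall n, V (v n)) ->
  exists (phi : nat -> nat) (w : R -> E),
    {homo phi : m n / (m < n)%N >-> (m < n)%N} /\ in_Lp p 0 T w /\
    LpnormE p 0 T (fun x => v (phi n) x - w x) @[n --> \oo] --> 0%E.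

Definition cont_repr (T : R) (v w : R -> E) : Prop :=
  {within `[0, T], continuous w} /\ {ae mu, forall x, x \in `[0, T] -> w x = v x}.

(** relative compactness in C([0,T];E) of V, elements of V being identified
    with their continuous representatives *)
Definition rel_compact_C (T : R) (V : set (R -> E)) : Prop :=
  (forall v, V v -> exists w, cont_repr T v w) /\
  forall (v w : nat -> R -> E), (forall n, V (v n)) -> (forall n, cont_repr T (v n) (w n)) ->
  exists (phi : nat -> nat) (z : R -> E),
    {homo phi : m n / (m < n)%N >-> (m < n)%N} /\ {within `[0, T], continuous z} /\
    forall eps : R, 0 < eps -> \forall n \near \oo,
      forall x, x \in `[0, T] -> `|w (phi n) x - z x| <= eps.

End Bochner.

Definition compact_operator (R : realType) (E1 E2 : normedModType R) (B : E1 -> E2) : Prop :=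
  forall A : set E1, bounded_set A -> compact (closure (B @` A)).

(* Main.v *)
Require Import Defs.
From HB Require Import structures.
From mathcomp Require Import all_boot all_order all_algebra.
From mathcomp Require Import all_classical all_reals all_analysis.
From mathcomp Require Import measurable_realfun ess_sup_inf ring lra.
Import Order.TTheory GRing.Theory Num.Theory.
Import numFieldNormedType.Exports.
Local Open Scope classical_set_scope.
Local Open Scope ring_scope.

(** Cut [0,T] into n+1 cells of width h = T/(n+1). For u in U and s in ]0,h[,
    compare v = B o u with the step function equal to v(kh+s) on the k-th cell.
    Averaging over s, Tonelli's theorem and the translation hypothesis bound the
    mean p-th power error by twice that of the translates, while the mean of
    \sum_k |u(kh+s)| is controlled by the L^1 norm of u. Hence some s makes the
    error small and all the samples u(kh+s) bounded by a constant that depends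
    only on n and on the L^1 bound. The values of the step function then lie in
    the relatively compact image under B of a fixed ball, so V is within epsilon
    of a totally bounded family of step functions. This avoids Bochner
    integrals. For p = +oo the same step functions converge uniformly to the
    continuous representative of v. *)

(** * Translation invariance and monotonicity of the integral *)

(** Since [B] may be discontinuous and nonlinear, averaging u over a cell is useless: [B] of a mean
    says nothing about the mean of B(u). The step values must be [B] of genuine values u(a) with
    |u(a)| under control, hence the sampling. Values at a prescribed point are meaningless for
    almost everywhere classes, so the offset s is chosen by averaging, outside the null sets where
    Borel versions differ from u and v. The bound on the samples degrades as the cells shrink, which
    is harmless: the number of cells depends only on epsilon, and compactness is used for one
    epsilon at a time. Averaging a p-th power makes no sense for p = +oo; there the power is
    replaced by a penalty with values 0 and +oo, so that Tonelli's theorem, the averaging argument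
    and Fatou's lemma apply to both cases at once. *)

#[local] Instance lebesgue_ae_filter (R : realType) :
  Filter (nbhs (almost_everywhere (@lebesgue_measure R))).
Proof. exact: (@ae_filter_ringOfSetsType _ (measurableTypeR R)). Qed.

Section Translation.
Variable R : realType.
Local Notation mu := (@lebesgue_measure R).

Let measurable_shift (h : R) :
  measurable_fun setT (fun x : measurableTypeR R => x + h : measurableTypeR R).
Proof. exact: measurable_funD. Qed.

(** The pushforward of [mu] under the shift gives each half-open interval its length, and this
    characterizes Lebesgue measure. *)
Lemma lebesgue_measure_shift (h : R) (A : set R) : measurable A ->
  mu ((fun x => x + h) @^-1` A) = mu A.
Proof.
move=> mA; pose f : measurableTypeR R -> measurableTypeR R := fun x => x + h.
pose mf := isMeasurableFun.Build _ _ _ _ f (measurable_shift h).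
pose F : {mfun measurableTypeR R >-> measurableTypeR R} := HB.pack f mf.
apply/esym; apply: (@lebesgue_measure_unique R (pushforward mu F)) => //.
move=> X [[a b]/= _ <-].
rewrite /pushforward /=.
have -> : f @^-1` `]a, b] = `]a - h, b - h]%classic.
  by apply/seteqP; split => x /=; rewrite !in_itv/= ltrBlDr lerBrDr.
rewrite !lebesgue_measure_itv/= !lte_fin ltrD2r -!EFinB.
by rewrite opprB addrA subrK.
Qed.

Lemma ge0_integral_shift (h : R) (f : R -> \bar R) :
  measurable_fun setT f -> (forall x, 0 <= f x)%E ->
  (\int[mu]_x f (x + h)%R = \int[mu]_x f x)%E.
Proof.
move=> mf f0; pose g : measurableTypeR R -> measurableTypeR R := fun x => x + h.
have mg : measurable_fun setT g by exact: measurable_shift.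
pose gm := isMeasurableFun.Build _ _ _ _ g mg.
pose G : {mfun measurableTypeR R >-> measurableTypeR R} := HB.pack g gm.
have := @ge0_integral_pushforward _ _ _ _ _ _ mg mu setT f measurableT mf.
rewrite preimage_setT => <-//.
apply: (@eq_measure_integral _ _ _ _ mu (pushforward mu G)) => A mA _.
exact: lebesgue_measure_shift.
Qed.

Lemma ae_shift (h : R) (P : R -> Prop) :
  {ae mu, forall x, P x} -> {ae mu, forall x, P (x + h)}.
Proof.
move=> [N [mN N0 PN]]; exists ((fun x => x + h) @^-1` N); split => //.
- rewrite -[X in measurable X]setTI; apply: measurable_shift => //.
- by rewrite lebesgue_measure_shift.
- by move=> x /= nP; apply: PN.
Qed.

End Translation.

Import HBNNSimple.

Section AeMonotone.
Context d (T : measurableType d) (R : realType).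
Variable mu : {measure set T -> \bar R}.
Local Open Scope ereal_scope.

(** Holds without measurability, because the integral of a nonnegative function is a supremum over
    the simple functions below it. *)
Lemma ge0_integral_mono (f g : T -> \bar R) :
  (forall x, 0 <= f x) -> (forall x, f x <= g x) ->
  \int[mu]_x f x <= \int[mu]_x g x.
Proof.
move=> f0 fg; have g0 x : 0 <= g x by exact: le_trans (fg x).
rewrite !ge0_integralTE//; apply: ge_ereal_sup => _ /= [h hf <-].
by apply: ereal_sup_ubound; exists h => // x; exact: le_trans (fg x).
Qed.

(** Functions that are strongly measurable in the sense of the statement are only
    a.e. equal to Borel functions, so one of the two may fail to be measurable;
    its integral is then the lower integral. *)
Lemma ae_ge0_integral_mono (f g : T -> \bar R) :
  (forall x, 0 <= f x) -> (forall x, 0 <= g x) ->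
  measurable_fun setT f \/ measurable_fun setT g ->
  (\forall x \ae mu, f x <= g x) -> \int[mu]_x f x <= \int[mu]_x g x.
Proof.
move=> f0 g0 mfg [N [mN N0 fgN]].
have fg x : ~ N x -> f x <= g x by move=> nN; apply: contrapT => /fgN.
have mifN (u v : T -> \bar R) : measurable_fun setT u -> measurable_fun setT v ->
    measurable_fun setT (fun x => if x \in N then u x else v x).
  move=> mu' mv; apply: measurable_fun_ifT => //.
  apply: (measurable_fun_bool true).
  by rewrite setTI (_ : _ @^-1` _ = N)//; apply/seteqP; split => x;
    [exact: set_mem|exact: mem_set].
have ae_notN : \forall x \ae mu, x \notin N.
  by exists N; split => // x /= /negP; rewrite negbK inE.
(* The measurable function of the two can be changed on [N] without affecting its integral: [f] is
   lowered to 0 there, or [g] raised to +oo, and the inequality then holds everywhere. *)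
case: mfg => [mf|mg].
- pose f' x := if x \in N then 0 else f x.
  rewrite (@ge0_ae_eq_integral _ _ _ mu setT f f')//.
  + apply: ge0_integral_mono => x; rewrite /f'; case: ifPn => //.
    by rewrite notin_setE => /fg.
  + exact: mifN.
  + by move=> x _; rewrite /f'; case: ifPn.
  + by apply: filterS ae_notN => x xN _; rewrite /f' (negbTE xN).
- pose g' x := if x \in N then +oo else g x.
  rewrite (@ge0_ae_eq_integral _ _ _ mu setT g g')//.
  + apply: ge0_integral_mono => // x; rewrite /g'; case: ifPn => //.
      by rewrite leey.
    by rewrite notin_setE => /fg.
  + exact: mifN.
  + by move=> x _; rewrite /g'; case: ifPn.
  + by apply: filterS ae_notN => x xN _; rewrite /g' (negbTE xN).
Qed.

Lemma le_poweR (r : R) (x y : \bar R) : (0 <= r)%R -> 0 <= x -> x <= y ->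
  x `^ r <= y `^ r.
Proof.
move=> r0 x0 xy; apply: (@gt0_ler_poweR R r r0) => //.
  by rewrite in_itv/= x0 leey.
by rewrite in_itv/= (le_trans x0 xy) leey.
Qed.

Lemma ae_le_Lnorm (p : \bar R) (f g : T -> R) : 1 <= p ->
  measurable_fun setT f \/ measurable_fun setT g ->
  (\forall x \ae mu, (`|f x| <= `|g x|)%R) ->
  Lnorm mu p (EFin \o f) <= Lnorm mu p (EFin \o g).
Proof.
case: p => [r||]// => [r1|_] mfg fg; rewrite unlock; last first.
- case: ifPn => // _; apply: le_ess_sup.
  by apply: filterS fg => x /=; rewrite lee_fin.
- have r0 : (0 < r)%R by rewrite (lt_le_trans ltr01).
  have mpow (u : T -> R) : measurable_fun setT u ->
      measurable_fun setT (fun x => (`|u x| `^ r)%:E).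
    move=> mu'; apply/measurable_EFinP.
    apply: (measurableT_comp (measurable_powR r)); exact: measurableT_comp.
  apply: le_poweR; first by rewrite invr_ge0 ltW.
  + by apply: integral_ge0 => // x _; exact: poweR_ge0.
  + apply: ae_ge0_integral_mono.
    * by move=> x; exact: poweR_ge0.
    * by move=> x; exact: poweR_ge0.
    * by case: mfg => /mpow; [left|right].
    apply: filterS fg => x /= fgx.
    by rewrite lee_fin ge0_ler_powR// ?nnegrE// ltW.
Qed.

End AeMonotone.

(** * Lp norms for finite and infinite p *)

Section Theta.
Variable R : realType.
Local Notation mu := (@lebesgue_measure R).
Variables (p : \bar R) (e : R).
Hypotheses (p1 : (1 <= p)%E) (e0 : 0 < e).
Local Open Scope ereal_scope.

(** For f >= 0 the bound ||f||_p <= e is equivalent to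
    \int theta(f) <= theta_bound, for finite and for infinite p. *)
Definition theta (y : R) : \bar R :=
  if p is r%:E then (y `^ r)%:E else if (y <= e)%R then 0 else +oo.

Definition theta_bound : R := if p is r%:E then (e `^ r)%R else 1%R.

Lemma theta_ge0 y : 0 <= theta y.
Proof.
by rewrite /theta; case: p => [r||]; rewrite ?lee_fin ?powR_ge0//; case: ifP.
Qed.

Lemma theta0 : theta 0 = 0.
Proof.
rewrite /theta; case: p p1 => [r||]//; rewrite ?(ltW e0)// lee_fin => r1.
by rewrite powR0// gt_eqF// (lt_le_trans _ r1).
Qed.

Lemma theta_bound_gt0 : (0 < theta_bound)%R.
Proof. by rewrite /theta_bound; case: p => [r||]//; rewrite powR_gt0. Qed.

Lemma measurable_theta : measurable_fun setT theta.
Proof.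
rewrite /theta; case: p => [r||]; last 2 first.
- by apply: measurable_fun_ifT => //; exact: measurable_fun_ler.
- by apply: measurable_fun_ifT => //; exact: measurable_fun_ler.
- by apply/measurable_EFinP; exact: measurable_powR.
Qed.


Lemma lebesgue_measure_setT_gt0 : 0 < mu setT.
Proof. by rewrite -set_itvNyy lebesgue_measure_itv/= addye ?ltry. Qed.

Lemma theta_le_Lnorm (f : R -> R) :
  (forall x, 0 <= f x)%R -> Lnorm mu p (EFin \o f) <= e%:E ->
  \int[mu]_x theta (f x) <= theta_bound%:E.
Proof.
move=> f0; rewrite /theta /theta_bound.
case: p p1 => [r||]// => [r1 Nfe|_]; last first.
- rewrite unlock ifT; last exact: lebesgue_measure_setT_gt0.
  move=> /ess_supP fe.
  apply: (@le_trans _ _ (\int[mu]_x 0)); last by rewrite integral0.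
  apply: ae_ge0_integral_mono => //; first by move=> x; case: ifP.
    by right; exact: measurable_cst.
  by apply: filterS fe => x /=; rewrite lee_fin ger0_norm// => ->.
- have r0 : (0 < r)%R by rewrite (lt_le_trans ltr01).
  have -> : \int[mu]_x (f x `^ r)%:E = Lnorm mu r%:E (EFin \o f) `^ r.
    rewrite poweR_Lnorm ?gt_eqF//; apply: eq_integral => x _ /=.
    by rewrite ger0_norm.
  rewrite -poweR_EFin; apply: le_poweR => //; [exact: ltW|exact: Lnorm_ge0].
Qed.

(** For finite p the p-th root of C is at most C because C >= 1. For p = +oo, a function with values
    0 and +oo and finite integral vanishes almost everywhere, so f <= e almost everywhere. *)
Lemma Lnorm_le_theta (C : R) (f : R -> R) : (1 <= C)%R ->
  measurable_fun setT f -> (forall x, 0 <= f x)%R ->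
  \int[mu]_x theta (f x) <= (C * theta_bound)%:E ->
  Lnorm mu p (EFin \o f) <= (C * e)%:E.
Proof.
move=> C1 mf f0; have mtf : measurable_fun setT (theta \o f).
  exact: (measurableT_comp measurable_theta).
have C0 : (0 < C)%R by rewrite (lt_le_trans ltr01).
move: mtf; rewrite /theta /theta_bound.
case: p p1 => [r||]// => [r1 _ Nfe|_ mtf fC]; last first.
- rewrite unlock ifT; last exact: lebesgue_measure_setT_gt0.
  apply/ess_supP.
  have /integrable_ae : mu.-integrable setT
      (fun x => if (f x <= e)%R then 0 else +oo).
    apply/integrableP; split=> //; apply: le_lt_trans (ltry (C * 1)%R).
    apply: le_trans fC; apply: ge0_integral_mono => x; first exact: abse_ge0.
    by case: ifP => _; rewrite ?abse0.
  move=> /(_ measurableT); apply: filterS => x /(_ Logic.I) /=.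
  case: ifP => // fe _; rewrite lee_fin ger0_norm// (le_trans fe)//.
  by rewrite ler_peMl// ltW.
- have r0 : (0 < r)%R by rewrite (lt_le_trans ltr01).
  have C1r : (C <= C `^ r)%R by exact: le1r_powR.
  have -> : (C * e)%:E = ((C * e)%R `^ r)%:E `^ r^-1.
    by rewrite poweR_EFin -powRrM mulfV ?gt_eqF// powRr1// mulr_ge0// ltW.
  rewrite unlock; apply: le_poweR.
  + by rewrite invr_ge0 ltW.
  + by apply: integral_ge0 => // x _; exact: poweR_ge0.
  + under eq_integral do rewrite /= ger0_norm//.
    apply: (le_trans Nfe).
    rewrite lee_fin powRM; [|exact: ltW..].
    by rewrite ler_wpM2r// powR_ge0.
Qed.

(** The semicontinuity behind Fatou's lemma. Nothing is to prove where [theta y] is 0; elsewhere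
    [theta] is continuous, by differentiability of the power at y > 0 or because y > e is an open
    condition. *)
Lemma theta_lsc (u : R^nat) (y : R) : (forall n, 0 <= u n)%R ->
  u n @[n --> \oo] --> y -> theta y <= limn_einf (theta \o u).
Proof.
move=> u0 uy; have y0 : (0 <= y)%R.
  rewrite -(cvg_lim _ uy)//; apply: limr_ge; first by apply/cvg_ex; exists y.
  exact: nearW.
have liminf0 : 0 <= limn_einf (theta \o u).
  rewrite limn_einf_lim; apply: lime_ge; first exact: is_cvg_einfs.
  by apply: nearW => n; apply: le_ereal_inf_tmp => _ [k _ <-]; exact: theta_ge0.
suff [->//|H] : theta y = 0 \/ theta (u n) @[n --> \oo] --> theta y.
  by rewrite (cvg_limn_einf_sup H).1.
rewrite /theta; case: p p1 => [r||]// => [r1|_].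
- have r0 : (0 < r)%R by rewrite (lt_le_trans ltr01).
  move: y0; rewrite le_eqVlt => /predU1P[<-|y0]; first by left; rewrite powR0 ?gt_eqF.
  right; apply/fine_cvgP; split; first exact: nearW.
  apply: (cvg_comp u (fun t : R => t `^ r)%R uy).
  have /derivable1_diffP : derivable (fun t : R => t `^ r)%R y 1.
    by apply: derivable_powR; rewrite in_itv/= y0.
  by move=> /differentiable_continuous.
- case: leP => [_|ey]; first by left.
  right; apply/cvgeyPge => A.
  have : \forall n \near \oo, (e < u n)%R by apply: (cvgr_gt y).
  by apply: filterS => n; rewrite ltNge => /negbTE ->; rewrite leey.
Qed.

Lemma Lnorm_fatou (f_ : nat -> R -> R) (f : R -> R) :
  (forall n, measurable_fun setT (f_ n)) -> measurable_fun setT f ->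
  (forall n x, 0 <= f_ n x)%R -> (forall x, 0 <= f x)%R ->
  {ae mu, forall x, f_ n x @[n --> \oo] --> f x} ->
  (\forall n \near \oo, Lnorm mu p (EFin \o f_ n) <= e%:E) ->
  Lnorm mu p (EFin \o f) <= e%:E.
Proof.
move=> mf_ mf f_0 f0 cvgf near_e.
have mtf_ n : measurable_fun setT (theta \o f_ n).
  exact: (measurableT_comp measurable_theta).
have mtf : measurable_fun setT (theta \o f).
  exact: (measurableT_comp measurable_theta).
rewrite -[e]mul1r; apply: Lnorm_le_theta => //; rewrite mul1r.
apply: (@le_trans _ _ (\int[mu]_x limn_einf (fun n => theta (f_ n x)))).
  apply: ae_ge0_integral_mono.
  - by move=> x; exact: theta_ge0.
  - move=> x; rewrite limn_einf_lim; apply: lime_ge; first exact: is_cvg_einfs.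
    by apply: nearW => n; apply: le_ereal_inf_tmp => _ [k _ <-]; exact: theta_ge0.
  - by left.
  - by apply: filterS cvgf => x; exact: theta_lsc.
apply: (le_trans (@fatou _ _ _ mu _ measurableT (fun n x => theta (f_ n x)) _ _)) => //.
  by move=> n x _; exact: theta_ge0.
rewrite limn_einf_lim; apply: lime_le; first exact: is_cvg_einfs.
apply: filterS near_e => n Hn; apply: ereal_inf_le.
by exists (\int[mu]_x theta (f_ n x)); [exists n => /=|exact: theta_le_Lnorm].
Qed.

(** On [0,T] a constant c has norm c T^(1/p), and T^(1/p) <= T + 1 for all p >= 1, so the threshold
    e / (T + 1) serves every exponent. *)
Lemma Lnorm_bounded (T : R) (f : R -> R) : (0 < T)%R ->
  measurable_fun setT f -> (forall x, 0 <= f x)%R ->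
  (forall x, f x <= if x \in `[0%R, T] then e / (T + 1) else 0)%R ->
  Lnorm mu p (EFin \o f) <= e%:E.
Proof.
move=> T0 mf f0 fT; have T10 : (0 < T + 1)%R by rewrite addr_gt0.
have ed : (e / (T + 1) <= e)%R.
  by rewrite ler_pdivrMr// ler_peMr ?(ltW e0)// lerDr ltW.
rewrite -[e]mul1r; apply: Lnorm_le_theta => //; rewrite mul1r.
pose c : \bar R := if p is r%:E then ((e / (T + 1)) `^ r)%:E else 0.
have c0 : 0 <= c by rewrite /c; case: p => // r; rewrite lee_fin powR_ge0.
apply: (@le_trans _ _ (\int[mu]_(x in `[0%R, T]) c)).
  rewrite [leRHS]integral_mkcond; apply: ge0_integral_mono => x.
    exact: theta_ge0.
  rewrite patchE; have := fT x; rewrite mem_setE; case: ifPn => _ fx; last first.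
    by rewrite (_ : f x = 0%R) ?theta0//; apply/eqP; rewrite eq_le fx f0.
  rewrite /theta /c; case: p p1 => [r||]//; last by rewrite (le_trans fx ed).
  rewrite !lee_fin => r1; rewrite ge0_ler_powR ?nnegrE//.
    by rewrite (le_trans _ r1).
  by rewrite divr_ge0// ltW.
have muT : mu `[0%R, T] = T%:E.
  by rewrite lebesgue_measure_itv/= lte_fin T0 oppr0 adde0.
apply: (@le_trans _ _ (c * T%:E)); first by rewrite -muT integral_cst.
rewrite /c /theta_bound; case: p p1 => [r||]//; last by rewrite mul0e.
rewrite !lee_fin => r1; rewrite powRM; [|exact: ltW|by rewrite invr_ge0 ltW].
rewrite -mulrA ler_piMr ?powR_ge0//.
have T1inv : (0 < (T + 1)^-1 <= 1)%R by rewrite invr_gt0 T10 invf_le1// lerDr ltW.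
apply: (@le_trans _ _ ((T + 1)^-1 * T)%R).
  by rewrite ler_wpM2r ?(ltW T0)// ge1r_powR.
by rewrite mulrC ler_pdivrMr// mul1r lerDl.
Qed.

End Theta.

(** * Strong measurability *)

Section FiniteRange.
Context d (T : measurableType d) (X : choiceType) (f : T -> X).
Hypothesis ff : finite_set (range f).
Hypothesis mf : forall y, measurable (f @^-1` [set y]).

(** [A] is arbitrary: its preimage is a finite union of level sets, so [X] carries no
    sigma-algebra. *)
Lemma finite_range_preimage (A : set X) : measurable (f @^-1` A).
Proof.
have -> : f @^-1` A = \bigcup_(y in range f `&` A) f @^-1` [set y].
  apply/seteqP; split => x /=.
    by move=> Afx; exists (f x) => //; split => //; exists x.
  by move=> [y [_ Ay] /= ->].
apply: fin_bigcup_measurable => //.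
by apply: sub_finite_set ff; exact: subIsetl.
Qed.

Lemma finite_range_measurable d' (Y : measurableType d') (phi : X -> Y) :
  measurable_fun setT (fun x => phi (f x)).
Proof.
by move=> _ A mA; rewrite setTI; exact: (finite_range_preimage (phi @^-1` A)).
Qed.

End FiniteRange.

Section Nice.
Context {R : realType} {E : normedModType R}.
Local Notation mu := (@lebesgue_measure R).
Implicit Types f g : R -> E.

(** Unlike [strongly_measurable_on], convergence holds everywhere, which makes the
    norm Borel measurable. *)
Definition simple_limit f := exists g : nat -> R -> E, (forall n, simple_function (g n)) /\
  forall x, g n x @[n --> \oo] --> f x.

Lemma simple_function2 (F : E -> E -> E) f g : simple_function f ->
  simple_function g -> simple_function (fun x => F (f x) (g x)).
Proof.
move=> [ff mf] [fg mg]; pose h (x : measurableTypeR R) := (f x, g x).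
have fh : finite_set (range h).
  apply: (@sub_finite_set _ _ (range f `*` range g)); last exact: finite_setX.
  by move=> _ [x _ <-]; split; exists x.
have mh z : measurable (h @^-1` [set z]).
  rewrite (_ : _ @^-1` _ = f @^-1` [set z.1] `&` g @^-1` [set z.2]).
    by apply: measurableI; [exact: mf|exact: mg].
  by apply/seteqP; split => x /=; [move=> <-|case: z => a b /= [<- <-]].
split.
  apply: sub_finite_set (finite_image (fun z => F z.1 z.2) fh) => _ [x _ <-].
  by exists (h x) => //; exists x.
move=> y; have mA : measurable (h @^-1` [set z | F z.1 z.2 = y]).
  exact: finite_range_preimage.
by [].
Qed.

Lemma simple_function_shift (a : R) f : simple_function f ->
  simple_function (fun x => f (x + a)).
Proof.
move=> [ff mf]; split.
  by apply: sub_finite_set ff => _ [x _ <-]; exists (x + a).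
move=> y; have ma : measurable_fun setT (fun x : R => x + a).
  exact: measurable_funD.
by have := ma measurableT _ (mf y); rewrite setTI.
Qed.

Lemma simple_function_cst (y : E) : simple_function (fun _ : R => y).
Proof.
split; first by apply: (@sub_finite_set _ _ [set y]) => // _ [x _ <-].
by move=> z; rewrite preimage_cst; case: ifP.
Qed.

Lemma simple_function_if (A : set R) f g : measurable A -> simple_function f ->
  simple_function g -> simple_function (fun x => if x \in A then f x else g x).
Proof.
move=> mA [ff mf] [fg mg]; split.
  apply: (@sub_finite_set _ _ (range f `|` range g)); last by rewrite finite_setU.
  by move=> _ [x _ <-]; case: ifP => _; [left|right]; exists x.
move=> y; rewrite (_ : _ @^-1` _ = (A `&` f @^-1` [set y]) `|`
                                  (~` A `&` g @^-1` [set y])).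
  by apply: measurableU; apply: measurableI => //; exact: measurableC.
apply/seteqP; split => x /=.
  by case: ifPn => [/set_mem xA|/negP xA] <-; [left|right; split => // /mem_set].
by move=> [[/mem_set -> //]|[xA <-]]; rewrite memNset.
Qed.

Lemma simple_function_limit f : simple_function f -> simple_limit f.
Proof. by move=> sf; exists (fun _ => f); split=> // x; exact: cvg_cst. Qed.

Lemma simple_limitB f g : simple_limit f -> simple_limit g ->
  simple_limit (fun x => f x - g x).
Proof.
move=> [F [sF Ff]] [G [sG Gg]]; exists (fun n x => F n x - G n x); split.
  by move=> n; exact: (@simple_function2 (fun a b => a - b)).
by move=> x; exact: cvgB.
Qed.

Lemma simple_limit_shift (a : R) f : simple_limit f -> simple_limit (fun x => f (x + a)).
Proof.
move=> [F [sF Ff]]; exists (fun n x => F n (x + a)); split => //.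
by move=> n; exact: simple_function_shift.
Qed.

Lemma simple_limit_strongly_measurable (a b : R) f : simple_limit f ->
  strongly_measurable_on a b f.
Proof. by move=> [F [sF Ff]]; exists F; split => //; exact: aeW. Qed.

(** Setting the approximants to 0 outside [a,b] and on a measurable null set containing the points
    of non-convergence makes them converge everywhere. *)
Lemma strongly_measurable_simple_limit (a b : R) f : strongly_measurable_on a b f ->
  exists2 f', simple_limit f' & {ae mu, forall x, x \in `[a, b] -> f' x = f x}.
Proof.
move=> [g [sg [N [mN N0 gN]]]].
pose A := `[a, b] `\` N; have mA : measurable A by exact: measurableD.
exists (fun x => if x \in A then f x else 0).
  exists (fun n x => if x \in A then g n x else 0); split.
    by move=> n; apply: simple_function_if => //; exact: simple_function_cst.
  move=> x; case: ifPn => [/set_mem [xab xN]|_]; last exact: cvg_cst.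
  by apply: contrapT => H; apply: xN; apply: gN => /(_ xab).
exists N; split => // x /= H; apply: contrapT => xN; apply: H => xab.
by rewrite mem_set.
Qed.

Lemma simple_limit_measurable_norm f : simple_limit f -> measurable_fun setT (fun x => `|f x|).
Proof.
move=> [F [sF Ff]].
apply: (@measurable_fun_cvg _ _ _ setT (fun n x => `|F n x|)).
  move=> n; have [fF mF] := sF n.
  exact: (@finite_range_measurable _ (measurableTypeR R) _ (F n) fF mF _ R Num.norm).
by move=> x _; apply: cvg_norm; exact: Ff.
Qed.

(** Provides the joint measurability that Tonelli's theorem asks of the sampling error. The pair is
    approximated by finite-valued maps whose level sets are measurable rectangles. *)
Lemma simple_limit_measurable_dist f : simple_limit f ->
  measurable_fun setT (fun z : measurableTypeR R * measurableTypeR R =>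
    `|f z.1 - f z.2| : R).
Proof.
move=> [F [sF Ff]].
apply: (@measurable_fun_cvg _ _ _ setT (fun n z => `|F n z.1 - F n z.2|)).
  move=> n; have [fF mF] := sF n.
  pose h (z : measurableTypeR R * measurableTypeR R) := (F n z.1, F n z.2).
  apply: (@finite_range_measurable _ _ _ h _ _ _ R (fun y => `|y.1 - y.2|)).
    apply: (@sub_finite_set _ _ (range (F n) `*` range (F n))).
      by move=> _ [x _ <-]; split; [exists x.1|exists x.2].
    exact: finite_setX.
  move=> y; rewrite (_ : _ @^-1` _ =
      (F n @^-1` [set y.1]) `*` (F n @^-1` [set y.2])).
    by apply: measurableX; exact: mF.
  by apply/seteqP; split => x /=; [move=> <-|case: y => u v /= [<- <-]].
by move=> z _; apply: cvg_norm; apply: cvgB; exact: Ff.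
Qed.

End Nice.

(** * Lp norms of vector-valued functions *)

Section Lp.
Context {R : realType} {E : normedModType R}.
Local Notation mu := (@lebesgue_measure R).
Implicit Types f g : R -> E.

Definition normr_on (a b : R) f x : R := if x \in `[a, b] then `|f x| else 0.

Lemma LpnormE_normr_on p a b f : LpnormE p a b f = Lnorm mu p (EFin \o normr_on a b f).
Proof. by []. Qed.

Lemma normr_on_ge0 a b f x : 0 <= normr_on a b f x.
Proof. by rewrite /normr_on; case: ifP. Qed.

Lemma measurable_normr_on a b f : simple_limit f -> measurable_fun setT (normr_on a b f).
Proof.
move=> nf; apply: measurable_fun_ifT => //; last exact: simple_limit_measurable_norm.
apply: (measurable_fun_bool true); rewrite setTI.
by rewrite (_ : _ @^-1` _ = `[a, b]%classic)//.
Qed.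

(** Only the norm of [f'] is known to be Borel. As [ae_le_Lnorm] asks measurability of one side
    only, it gives both inequalities. *)
Lemma ae_eq_LpnormE (p : \bar R) a b f f' : (1 <= p)%E -> simple_limit f' ->
  {ae mu, forall x, x \in `[a, b] -> f' x = f x} ->
  LpnormE p a b f = LpnormE p a b f'.
Proof.
move=> p1 nf' ff'; rewrite !LpnormE_normr_on.
have mf' := measurable_normr_on a b _ nf'.
apply/eqP; rewrite eq_le; apply/andP; split; apply: ae_le_Lnorm => //.
- by right.
- by apply: filterS ff' => x; rewrite /normr_on; case: ifP => // _ ->.
- by left.
- by apply: filterS ff' => x; rewrite /normr_on; case: ifP => // _ ->.
Qed.

Lemma LpnormE_triangle (p : \bar R) a b f g h : (1 <= p)%E ->
  simple_limit f -> simple_limit g -> simple_limit h ->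
  (LpnormE p a b (fun x => f x - h x)%R
   <= LpnormE p a b (fun x => f x - g x)%R + LpnormE p a b (fun x => g x - h x)%R)%E.
Proof.
move=> p1 nf ng nh; rewrite !LpnormE_normr_on.
have m1 := measurable_normr_on a b _ (simple_limitB _ _ nf ng).
have m2 := measurable_normr_on a b _ (simple_limitB _ _ ng nh).
apply: le_trans (eminkowski mu m1 m2 p1).
apply: ae_le_Lnorm => //; first by right; exact: measurable_funD.
apply: aeW => x /=; rewrite /normr_on; case: ifP => _; last by rewrite addr0.
by rewrite normr_id ger0_norm ?addr_ge0// -{1}(subrKA (g x) (f x)) ler_normD.
Qed.

Lemma LpnormEB p a b f g :
  LpnormE p a b (fun x => f x - g x) = LpnormE p a b (fun x => g x - f x).
Proof.
rewrite !LpnormE_normr_on; apply: eq_Lnorm => x /=.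
by rewrite /normr_on distrC.
Qed.

End Lp.

(** * Uniform grids *)

Section Grid.
Variables (R : realType) (T : R) (n : nat).
Hypothesis T0 : 0 < T.

Definition cell_width : R := T / n.+1%:R.
Local Notation h := cell_width.

(** The minimum puts t = T, whose truncated quotient is n+1, into the last cell. *)
Definition cell (t : R) : nat := minn (Num.truncn (t / h)) n.

Lemma cell_width_gt0 : 0 < h.
Proof. by rewrite divr_gt0. Qed.

Lemma cell_width_mul : n.+1%:R * h = T.
Proof. by rewrite mulrC divfK// pnatr_eq0. Qed.

Lemma cell_le t : (cell t <= n)%N.
Proof. exact: geq_minr. Qed.

Lemma le_cell t : 0 <= t -> (cell t)%:R * h <= t.
Proof.
move=> t0; rewrite -ler_pdivlMr ?cell_width_gt0//.
apply: (@le_trans _ _ (Num.truncn (t / h))%:R).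
  by rewrite ler_nat geq_minl.
have := truncn_itv (divr_ge0 t0 (ltW cell_width_gt0)).
by case/andP.
Qed.

Lemma cell_ge t : t <= T -> t <= (cell t)%:R * h + h.
Proof.
move=> tT; rewrite -[X in _ + X]mul1r -mulrDl natr1 /cell.
case: (leqP (Num.truncn (t / h)) n) => [|_]; last by rewrite cell_width_mul.
by rewrite -ler_pdivrMr ?cell_width_gt0// ltW// -truncn_le_nat.
Qed.

Lemma cell_gtE k t : (k < cell t)%N = (k < n)%N && (k.+1%:R <= t / h).
Proof. by rewrite leq_min truncn_gt_nat andbC. Qed.

Lemma cell_last t : n%:R * h <= t -> cell t = n.
Proof.
move=> ht; apply/minn_idPr; case: n ht (cell_width_gt0) => // m ht h0.
by rewrite truncn_gt_nat ler_pdivlMr.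
Qed.

Lemma measurable_cell (k : nat) : measurable (cell @^-1` [set k]).
Proof.
have mge j : measurable [set t | (j <= cell t)%N].
  case: j => [|j]; first by rewrite (_ : [set _ | _] = setT)// predeqE.
  rewrite (_ : [set _ | _] = if (j < n)%N then `[j.+1%:R * h, +oo[%classic else set0).
    by case: ifP.
  apply/seteqP; split => t /=; rewrite cell_gtE; case: (j < n)%N => //=;
    by rewrite in_itv/= andbT ler_pdivlMr ?cell_width_gt0.
rewrite (_ : _ @^-1` _ = [set t | (k <= cell t)%N] `\` [set t | (k < cell t)%N]).
  exact: measurableD.
apply/seteqP; split => t /=; first by move=> ->; rewrite leqnn ltnn.
by move=> [kt /negP]; rewrite -leqNgt => tk; apply/eqP; rewrite eqn_leq kt tk.
Qed.

Lemma finite_range_cell : finite_set (range cell).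
Proof.
apply: (@sub_finite_set _ _ `I_n.+1) => // _ [t _ <-] /=.
by rewrite ltnS cell_le.
Qed.

Lemma simple_function_cell (E : normedModType R) (c : nat -> E) :
  simple_function (fun t => c (cell t)).
Proof.
split.
  by apply: sub_finite_set (finite_image c finite_range_cell) => _ [t _ <-];
     exists (cell t) => //; exists t.
move=> y.
exact: (@finite_range_preimage _ (measurableTypeR R) _ cell finite_range_cell
  measurable_cell (c @^-1` [set y])).
Qed.

Lemma measurable_fun_cell : measurable_fun setT (fun t => (cell t)%:R * h).
Proof.
exact: (@finite_range_measurable _ (measurableTypeR R) _ cell finite_range_cell
  measurable_cell _ R (fun k => k%:R * h)).
Qed.

(** Cells are closed on the left. This right continuity later moves almost everywhere estimates to
    prescribed points. *)
Lemma cell_right x : 0 <= x -> \forall t \near x^'+, cell t = cell x.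
Proof.
move=> x0; have /andP[_ xk] := truncn_itv (divr_ge0 x0 (ltW cell_width_gt0)).
near=> t.
have xt : x < t by near: t; exact: nbhs_right_gt.
have tk : t < (Num.truncn (x / h)).+1%:R * h.
  near: t; apply: nbhs_right_lt; by rewrite -ltr_pdivrMr ?cell_width_gt0.
rewrite /cell; congr minn; apply: truncn_def.
rewrite ltr_pdivrMr ?cell_width_gt0// tk andbT.
have /andP[+ _] := truncn_itv (divr_ge0 x0 (ltW cell_width_gt0)).
move=> /le_trans; apply; rewrite ler_pM2r ?invr_gt0 ?cell_width_gt0//; exact: ltW.
Unshelve. all: by end_near. Qed.

End Grid.

(** * Sampling on a random grid *)

Section Averaging.
Variable R : realType.
Local Notation mu := (@lebesgue_measure R).
Local Open Scope ereal_scope.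

Lemma measurable_fun_in_itv d (X : measurableType d) (f : X -> R) (i : interval R) :
  measurable_fun setT f -> measurable_fun setT (fun x => f x \in i).
Proof.
move=> mf; apply: (measurable_fun_bool true).
have := mf measurableT [set` i] (measurable_itv i).
by rewrite !setTI.
Qed.

(** If g exceeded C at almost every point of ]0,h[, its integral would be at least C h. A null set
    can thus be avoided at no cost. *)
Lemma exists_le_average (h C : R) (g : R -> \bar R) (P : R -> Prop) :
  (0 < h)%R -> (0 <= C)%R -> measurable_fun setT g -> (forall x, 0 <= g x) ->
  \int[mu]_x g x < (C * h)%:E -> {ae mu, forall x, P x} ->
  exists s : R, [/\ (0 < s < h)%R, P s & g s <= C%:E].
Proof.
move=> h0 C0 mg g0 gC aeP; apply: contrapT => noS.
have : (C * h)%:E <= \int[mu]_x g x.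
  have muh : mu `]0%R, h[ = h%:E.
    by rewrite lebesgue_measure_itv/= lte_fin h0 oppr0 adde0.
  rewrite EFinM -muh.
  apply: (@le_trans _ _ (\int[mu]_x (if x \in `]0%R, h[ then C%:E else 0))).
    rewrite (_ : (fun x => _) = (fun=> C%:E) \_ (`]0%R, h[%classic : set R)).
      by rewrite -integral_mkcond integral_cst.
    by apply/funext => x; rewrite patchE mem_setE.
  have mC : measurable_fun setT (fun x : R => if x \in `]0%R, h[ then C%:E else 0).
    by apply: measurable_fun_ifT => //; exact: measurable_fun_in_itv.
  apply: ae_ge0_integral_mono => //.
  - by move=> x; case: ifP.
  - by left.
  - apply: filterS aeP => x Px; case: ifPn => [|_]; last exact: g0.
    rewrite in_itv/= => xh; rewrite leNgt; apply/negP => gxC; apply: noS.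
    by exists x; split => //; exact: ltW.
by rewrite leNgt gC.
Qed.

Variables (T : R) (n : nat).
Hypothesis T0 : (0 < T)%R.
Local Notation h := (cell_width R T n).
Variables (F : R * R -> \bar R) (c : R).
Hypotheses (mF : measurable_fun setT F) (F0 : forall z, 0 <= F z).
Hypothesis Fshift : forall tau : R, (`|tau| < h)%R ->
  \int[mu]_t (if (t \in `[0%R, T]) && ((t + tau)%R \in `[0%R, T])
    then F ((t + tau)%R, t) else 0) <= c%:E.

(** [F] will be [theta] of the distance between the values of v at its two arguments. Extension by 0
    lets both variables run over the whole line, where integrals are translation invariant. *)
Definition sampled (z : R * R) : \bar R :=
  if (z.1 \in `]0%R, h[) && (z.2 \in `[0%R, T])
  then F (((cell R T n z.2)%:R * h + z.1)%R, z.2) else 0.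

Lemma measurable_sampled : measurable_fun setT sampled.
Proof.
apply: measurable_fun_ifT => //.
  by apply: measurable_and; apply: measurable_fun_in_itv.
apply: measurableT_comp => //; apply: measurable_fun_pair => //.
apply: measurable_funD => //.
by apply: (measurableT_comp (measurable_fun_cell R T n T0)).
Qed.

Lemma sampled_ge0 z : 0 <= sampled z.
Proof. by rewrite /sampled; case: ifP. Qed.

(** After exchanging the integrals, the substitution tau = kh + s - t on the k-th
    cell turns s into a translation length with |tau| < h. *)
Lemma integral_sampled :
  \int[mu]_s \int[mu]_t sampled (s, t) <= (2 * h * c)%:E.
Proof.
have h0 := cell_width_gt0 R T n T0.
rewrite (@fubini_tonelli _ _ _ _ _ mu mu sampled measurable_sampled sampled_ge0).
pose I (z : R * R) := if (z.1 \in `]- h, h[%R) &&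
    ((z.2 \in `[0%R, T]) && ((z.2 + z.1)%R \in `[0%R, T]))
    then F ((z.2 + z.1)%R, z.2) else 0.
have mI : measurable_fun setT I.
  apply: measurable_fun_ifT => //.
    apply: measurable_and; first exact: measurable_fun_in_itv.
    apply: measurable_and; first exact: measurable_fun_in_itv.
    by apply: measurable_fun_in_itv; exact: measurable_funD.
  apply: measurableT_comp => //; apply: measurable_fun_pair => //.
  exact: measurable_funD.
have I0 z : 0 <= I z by rewrite /I; case: ifP.
apply: (@le_trans _ _ (\int[mu]_t \int[mu]_tau I (tau, t))).
  apply: ge0_integral_mono => t.
    by apply: integral_ge0 => s _; exact: sampled_ge0.
  have mIt : measurable_fun setT (fun tau => I (tau, t)).
    exact: measurable_fun_pair1.
  rewrite -(@ge0_integral_shift R ((cell R T n t)%:R * h - t)%R)//.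
  apply: ge0_integral_mono => s; first exact: sampled_ge0.
  rewrite /sampled /=; case: ifPn => // /andP[].
  rewrite !in_itv/= => /andP[s0 sh] /andP[t0 tT].
  have lc := le_cell R T n T0 t t0.
  have gc := cell_ge R T n T0 t tT.
  have ck : ((cell R T n t)%:R * h + h <= T)%R.
    rewrite -[X in (_ + X)%R]mul1r -mulrDl natr1 -[leRHS](cell_width_mul R T n).
    by rewrite ler_pM2r// ler_nat ltnS cell_le.
  have ch : (0 <= (cell R T n t)%:R * h)%R by rewrite mulr_ge0// ltW.
  have -> : ((cell R T n t)%:R * h + s = t + (s + ((cell R T n t)%:R * h - t)))%R.
    by lra.
  rewrite /I/= ifT//.
  rewrite !in_itv/=; apply/andP; split; [|apply/andP; split]; apply/andP; split; lra.
rewrite -(@fubini_tonelli _ _ _ _ _ mu mu I mI I0).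
(* The admissible translations fill an interval of length 2h, whence the factor 2 in the bound. *)
pose J : set R := [set` `](- h)%R, h[].
apply: (@le_trans _ _ (\int[mu]_(tau in J) c%:E)); last first.
  have muh : mu J = (2 * h)%:E.
    rewrite lebesgue_measure_itv/= lte_fin gtrN//.
    by rewrite -EFinB opprK mulr_natl mulr2n.
  by rewrite mulrC EFinM -muh integral_cst//; exact: measurable_itv.
rewrite [leRHS]integral_mkcond; apply: ge0_integral_mono => tau.
  by apply: integral_ge0 => s _; exact: I0.
rewrite patchE mem_setE; case: ifPn => tauh.
  apply: le_trans (Fshift tau _).
    by apply: ge0_integral_mono => t //; rewrite /I/= tauh.
  by move: tauh; rewrite in_itv/= ltr_norml.
rewrite integral0_eq// => t _.
by rewrite /I/= (negbTE tauh).
Qed.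

End Averaging.

Section Sampling.
Context {R : realType} {E1 E2 : normedModType R}.
Local Notation mu := (@lebesgue_measure R).
Local Open Scope ereal_scope.

(** The hypothesis covers positive translations. A negative one reduces to its opposite by the
    substitution t + tau, the integrand being symmetric in its two points. *)
Lemma integral_theta_shift (p : \bar R) (e T delta : R) (v : R -> E2) :
  1 <= p -> (0 < e)%R -> simple_limit v ->
  (forall h, (0 < h < delta)%R ->
     LpnormE p 0 (T - h) (fun x => v (x + h) - v x)%R <= e%:E) ->
  forall tau : R, (`|tau| < delta)%R ->
  \int[mu]_t (if (t \in `[0%R, T]) && ((t + tau)%R \in `[0%R, T])
     then theta R p e `|v (t + tau) - v t|%R else 0) <= (theta_bound R p e)%:E.
Proof.
move=> p1 e0 nv trans; pose I tau t :=
  if (t \in `[0%R, T]) && ((t + tau)%R \in `[0%R, T])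
  then theta R p e `|v (t + tau) - v t|%R else 0.
have I_pos tau : (0 < tau < delta)%R -> \int[mu]_t I tau t <= (theta_bound R p e)%:E.
  move=> taud; apply: (le_trans _ (theta_le_Lnorm R p e p1
    (normr_on 0 (T - tau) (fun x => v (x + tau) - v x)%R)
    (fun=> normr_on_ge0 _ _ _ _) (trans _ taud))).
  apply: ge0_integral_mono => t.
    by rewrite /I; case: ifP => // _; exact: theta_ge0.
  rewrite /I /normr_on; case: ifPn => [|_]; last exact: theta_ge0.
  rewrite !in_itv/= => /andP[/andP[t0 _] /andP[_ tT]].
  by rewrite t0 lerBrDr tT.
have mI tau : measurable_fun setT (I tau).
  apply: measurable_fun_ifT => //.
    apply: measurable_and; apply: measurable_fun_in_itv => //.
    exact: measurable_funD.
  apply: measurableT_comp; first exact: measurable_theta.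
  apply: simple_limit_measurable_norm.
  by apply: simple_limitB => //; exact: simple_limit_shift.
have I0 tau t : 0 <= I tau t by rewrite /I; case: ifP => // _; exact: theta_ge0.
move=> tau taud; rewrite -/(I tau).
have [tau0|tau0|tau0] := ltgtP 0%R tau.
- by apply: I_pos; rewrite tau0 (le_lt_trans _ taud)// ler_norm.
- have -> : \int[mu]_t I tau t = \int[mu]_t I (- tau)%R (t + tau)%R.
    by apply: eq_integral => t _; rewrite /I addrK andbC distrC.
  rewrite (@ge0_integral_shift R tau (I (- tau)%R))//; apply: I_pos.
  by rewrite oppr_gt0 tau0 (le_lt_trans _ taud)// -normrN ler_norm.
- rewrite integral0_eq; first by rewrite lee_fin ltW// theta_bound_gt0.
  move=> t _; rewrite -tau0 addr0 subrr normr0 theta0//; by case: ifP.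
Qed.

(** [u] and [v] share only the sample points [a k]. With v = B o u, the step function then takes as
    values [B] of vectors of bounded norm. *)
Lemma sampling (p : \bar R) (e T M : R) (n : nat) (u : R -> E1) (v : R -> E2) :
  1 <= p -> (0 < e)%R -> (0 < T)%R -> (0 <= M)%R ->
  strongly_measurable_on 0 T u -> LpnormE 1 0 T u <= M%:E ->
  strongly_measurable_on 0 T v ->
  (forall h, (0 < h < cell_width R T n)%R ->
     LpnormE p 0 (T - h) (fun x => v (x + h) - v x)%R <= e%:E) ->
  exists a : nat -> R, (forall k, (k <= n)%N ->
      `|u (a k)| <= 4 * n.+1%:R * (M + 1) / cell_width R T n)%R /\
    LpnormE p 0 T (fun x => v x - v (a (cell R T n x)))%R <= (4 * e)%:E.
Proof.
move=> p1 e0 T0 M0 su uM sv trans.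
have [u' nu' uu'] := strongly_measurable_simple_limit _ _ _ su.
have [v' nv' vv'] := strongly_measurable_simple_limit _ _ _ sv.
set h := cell_width R T n.
have h0 : (0 < h)%R := cell_width_gt0 R T n T0.
have trans' tau : (0 < tau < h)%R ->
    LpnormE p 0 (T - tau) (fun x => v' (x + tau) - v' x)%R <= e%:E.
  move=> th; rewrite -(ae_eq_LpnormE p _ _ (fun x => v (x + tau) - v x)%R) //.
  - exact: trans.
  - by apply: simple_limitB => //; exact: simple_limit_shift.
  - apply: filterS2 vv' (ae_shift _ tau _ vv') => x xv xtv.
    rewrite in_itv/= => /andP[x0 xT]; case/andP: th => th0 _.
    rewrite xv ?xtv ?in_itv/=//; apply/andP; split; lra.
pose c := theta_bound R p e.
have c0 : (0 < c)%R by exact: theta_bound_gt0.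
pose F (z : R * R) := theta R p e `|v' z.1 - v' z.2|%R.
have mF : measurable_fun setT F.
  apply: measurableT_comp; first exact: measurable_theta.
  exact: simple_limit_measurable_dist.
have F0 z : 0 <= F z by exact: theta_ge0.
have IF := integral_theta_shift p e T h v' p1 e0 nv' trans'.
pose S := sampled R T n F.
have mS : measurable_fun setT S := measurable_sampled R T n T0 F mF.
have S0 z : 0 <= S z by exact: sampled_ge0.
have IS : \int[mu]_s \int[mu]_t S (s, t) <= (2 * h * c)%:E.
  exact: (integral_sampled R T n T0 F c mF F0 IF).
pose Psi s := \int[mu]_t S (s, t).
have mPsi : measurable_fun setT Psi.
  exact: (measurable_fun_fubini_tonelli_F (m2 := mu) S mS S0).
have Psi0 s : 0 <= Psi s by apply: integral_ge0 => t _; exact: S0.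
(* A single s must serve both the error and the samples, so the two are added with a weight making
   the integral of the sample term at most h c. [M + 1] keeps the denominator positive when M =
   0. *)
pose lam := (h * c / (n.+1%:R * (M + 1)))%R.
have M1 : (0 < M + 1)%R by rewrite ltr_wpDl.
have lam0 : (0 < lam)%R by rewrite divr_gt0 ?mulr_gt0.
pose A k s := (normr_on 0 T u' (s + k%:R * h))%:E.
have mA k : measurable_fun setT (A k).
  apply/measurable_EFinP.
  apply: (measurableT_comp (measurable_normr_on 0%R T u' nu')).
  exact: measurable_funD.
have A0 k s : 0 <= A k s by rewrite lee_fin normr_on_ge0.
have IA k : \int[mu]_s A k s <= M%:E.
  rewrite (@ge0_integral_shift R (k%:R * h)%R (EFin \o normr_on 0 T u')).
  - apply: le_trans uM.
    rewrite (ae_eq_LpnormE _ _ _ u u')// LpnormE_normr_on Lnorm1.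
    apply: ge0_integral_mono => x; first by rewrite lee_fin normr_on_ge0.
    by rewrite lee_fin ler_norm.
  - by apply/measurable_EFinP; exact: measurable_normr_on.
  - by move=> x; rewrite lee_fin normr_on_ge0.
pose g s := Psi s + lam%:E * \sum_(k < n.+1) A k s.
have mg : measurable_fun setT g.
  apply: emeasurable_funD => //; apply: measurable_funeM.
  by apply: emeasurable_sum => k; exact: mA.
have sumA0 s : 0 <= \sum_(k < n.+1) A k s by exact: sume_ge0.
have g0 s : 0 <= g s.
  by rewrite adde_ge0// mule_ge0// lee_fin ltW.
have Ig : \int[mu]_s g s < (4 * c * h)%:E.
  have -> : \int[mu]_s g s =
      \int[mu]_s Psi s + lam%:E * \sum_(k < n.+1) \int[mu]_s A k s.
    rewrite ge0_integralD//.
    - rewrite ge0_integralZl_EFin//; last 2 first.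
      + by apply: emeasurable_sum => k; exact: mA.
      + exact: ltW.
      rewrite ge0_integral_sum//.
      by move=> k; exact: mA.
    - by move=> s _; rewrite mule_ge0// lee_fin ltW.
    - by apply: measurable_funeM; apply: emeasurable_sum => k; exact: mA.
  apply: (@le_lt_trans _ _ ((2 * h * c)%:E + lam%:E * (n.+1%:R * M)%:E)).
    apply: leeD; first exact: IS.
    rewrite lee_pmul2l//; apply: (@le_trans _ _ (\sum_(k < n.+1) M%:E)).
      exact: lee_sum.
    by rewrite sumEFin sumr_const card_ord mulr_natl.
  rewrite -EFinM -EFinD lte_fin.
  (* The total is at most 2hc + hc, strictly below the 4hc required by [exists_le_average]. *)
  have : (lam * (n.+1%:R * M) <= h * c)%R.
    rewrite /lam -mulrA ler_piMr//; first by rewrite mulr_ge0 ?(ltW h0) ?(ltW c0).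
    by rewrite ler_pdivrMl ?mulr_gt0// mulr1 ler_pM2l// lerDl.
  have : (0 < h * c)%R by rewrite mulr_gt0.
  lra.
have good : {ae mu, forall s : R, forall k : nat,
    (s + k%:R * h \in `[0%R, T] -> u' (s + k%:R * h) = u (s + k%:R * h) /\
      v' (s + k%:R * h) = v (s + k%:R * h))%R}.
  apply/ae_foralln => k.
  apply: filterS2 (ae_shift _ (k%:R * h)%R _ uu') (ae_shift _ (k%:R * h)%R _ vv').
  by move=> s us vs skh; split; [exact: us|exact: vs].
have [|s [/andP[s0 sh] gs Cs]] := exists_le_average _ h (4 * c)%R g _ h0 _ mg g0 Ig good.
  by rewrite mulr_ge0// ltW.
pose a (k : nat) := (s + k%:R * h)%R.
have ak k : (k <= n)%N -> a k \in `[0%R, T].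
  move=> kn; rewrite in_itv/=.
  have : (k%:R * h + h <= T)%R.
    rewrite -[X in (_ + X)%R]mul1r -mulrDl natr1 -[leRHS](cell_width_mul R T n).
    by rewrite ler_pM2r// ler_nat.
  have : (0 <= k%:R * h)%R by rewrite mulr_ge0// ltW.
  by rewrite /a => ? ?; apply/andP; split; lra.
(* Both summands of [g s] are nonnegative, so each is at most 4c: the weighted one bounds the
   samples, [Psi s] bounds the error. *)
exists a; split.
- move=> k kn; have [<- _] := gs k (ak k kn).
  have : lam%:E * A k s <= (4 * c)%:E.
    apply: le_trans Cs; rewrite /g.
    apply: (@le_trans _ _ (lam%:E * \sum_(k < n.+1) A k s)); last exact: leeDr.
    rewrite lee_pmul2l//.
    rewrite (bigD1 (Ordinal (kn : (k < n.+1)%N)))//= leeDl//.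
    exact: sume_ge0.
  rewrite /A /normr_on ak// -EFinM lee_fin mulrC -ler_pdivlMr//.
  move=> /le_trans; apply; rewrite le_eqVlt; apply/orP; left; apply/eqP.
  by rewrite /lam -/h; field; rewrite !gt_eqF.
- have Psis : Psi s <= (4 * c)%:E.
    by apply: le_trans Cs; rewrite /g leeDl// mule_ge0// lee_fin ltW.
  pose w x := v (a (cell R T n x)).
  have nw : simple_limit w.
    by apply: simple_function_limit; exact: (simple_function_cell R T n T0 _ (fun k => v (a k))).
  rewrite (ae_eq_LpnormE p _ _ _ (fun x => v' x - w x)%R) //; last 2 first.
  + exact: simple_limitB.
  + by apply: filterS vv' => x + xT => ->.
  rewrite LpnormE_normr_on; apply: Lnorm_le_theta => //.
  + by rewrite ler1n.
  + by apply: measurable_normr_on; exact: simple_limitB.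
  + by move=> x; exact: normr_on_ge0.
  apply: le_trans Psis; apply: ge0_integral_mono => x; first exact: theta_ge0.
  rewrite /normr_on; case: ifPn => xT; last by rewrite theta0.
  rewrite /S /sampled /= xT andbT in_itv/= s0 sh /=.
  rewrite /F /= /w distrC.
  have [_ <-] := gs _ (ak _ (cell_le R T n x)).
  by rewrite [(s + _)%R]addrC.
Qed.

End Sampling.

(** * Diagonal subsequences *)

Section Subsequences.

Definition cofinal_nat (S : set nat) := forall N, exists2 n, (N <= n)%N & S n.

Lemma cofinal_pigeonhole (F : finType) (col : nat -> F) (S : set nat) :
  cofinal_nat S -> exists c, cofinal_nat (S `&` col @^-1` [set c]).
Proof.
move=> cS; apply: contrapT => noc.
have /choice[N NP] : forall c : F, exists N, forall n, (N <= n)%N -> S n -> col n <> c.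
  move=> c; apply: contrapT => noN; apply: noc; exists c => N.
  apply: contrapT => nn; apply: noN; exists N => n Nn Sn cn; apply: nn.
  by exists n.
have [n Nn Sn] := cS (\max_(c : F) N c)%N.
by apply: (NP (col n) n _ Sn erefl); apply: leq_trans Nn; exact: leq_bigmax.
Qed.

(** Total boundedness enters as finite colorings. Each stage keeps an infinite monochromatic subset
    of the previous one, and [phi] picks increasing indices from the nested subsets. *)
Lemma diagonal_subsequence (near : nat -> nat -> nat -> Prop) :
  (forall k, exists (F : finType) (col : nat -> F),
    forall i j, col i = col j -> near k i j) ->
  exists phi : nat -> nat, {homo phi : m n / (m < n)%N >-> (m < n)%N} /\
    forall k i j, (k <= i)%N -> (k <= j)%N -> near k (phi i) (phi j).
Proof.
move=> coloring.
have /choice[refine refineP] : forall z : nat * {S : set nat | cofinal_nat S},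
    exists S' : {S : set nat | cofinal_nat S},
      sval S' `<=` sval z.2 /\
      forall i j, sval S' i -> sval S' j -> near z.1 i j.
  move=> [k [S cS]]; have [F [col colP]] := coloring k.
  have [c cSc] := cofinal_pigeonhole F col S cS.
  exists (exist _ _ cSc) => /=; split; first exact: subIsetl.
  by move=> i j [_ ci] [_ cj]; apply: colP; rewrite ci cj.
have cT : cofinal_nat setT by move=> N; exists N.
pose S := fix S k := if k is k'.+1 then refine (k', S k') else exist _ setT cT.
have S_sub i j : (i <= j)%N -> sval (S j) `<=` sval (S i).
  move=> /subnK <-; elim: (j - i)%N => [|m IH]; first exact: subset_refl.
  by apply: subset_trans IH; exact: (refineP (_, _)).1.
have /choice[pick pickP] : forall z : nat * nat,
    exists n, (z.2 <= n)%N /\ sval (S z.1) n.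
  by move=> [k N]; have [n Nn Sn] := svalP (S k) N; exists n.
(* The shift by one is needed: [S 0] is everything, and [near k] holds between members of
   [S k.+1]. *)
pose phi := fix phi k := if k is k'.+1 then pick (k.+1, (phi k').+1) else pick (1, 0)%N.
have phiS k : sval (S k.+1) (phi k) by case: k => [|k]; exact: (pickP (_, _)).2.
exists phi; split.
  by apply: homo_ltn => [|k]; [exact: ltn_trans|exact: (pickP (_, _)).1].
move=> k i j ki kj; apply: (refineP (k, S k)).2.
- by apply: (S_sub k.+1 i.+1 _ _ (phiS i)); rewrite ltnS.
- by apply: (S_sub k.+1 j.+1 _ _ (phiS j)); rewrite ltnS.
Qed.

(** The color of a point is the position of the first center within eta / 2 in a finite cover. The
    extra color keeps the ordinal type inhabited. *)
Lemma compact_coloring (R : realType) (E : normedModType R) (K : set E) (eta : R) :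
  compact K -> 0 < eta -> exists (m : nat) (col : E -> 'I_m),
    forall x y, K x -> K y -> col x = col y -> `|x - y| <= eta.
Proof.
move=> + eta0; rewrite compact_cover => cK.
have eta2 : 0 < eta / 2 by rewrite divr_gt0.
have [|x Kx|D _ KD] := cK E K (fun y => ball y (eta / 2)).
- by move=> y _; exact: ball_open.
- by exists x => //; exact: ballxx.
pose col (x : E) := find (fun d => `|d - x| < eta / 2) (finmap.enum_fset D).
exists (size (finmap.enum_fset D)).+1, (fun x => inord (col x)) => x y Kx Ky.
have has_col z : K z -> has (fun d => `|d - z| < eta / 2) (finmap.enum_fset D).
  move=> /KD[d dD]; rewrite -ball_normE => dz; apply/hasP; exists d => //.
have colK z : K z -> (col z < (size (finmap.enum_fset D)).+1)%N.
  by move=> /has_col; rewrite has_find => /ltnW.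
move=> /(congr1 val); rewrite /= !inordK ?colK// => xy.
have := nth_find 0 (has_col x Kx); have := nth_find 0 (has_col y Ky).
rewrite -/(col x) -/(col y) xy; set d := nth _ _ _ => dy dx.
rewrite -(subrKA d) (le_trans (ler_normD _ _))// distrC [leRHS]splitr ltW// ltrD//.
Qed.

End Subsequences.

(** * Completeness of Lp *)

Section Complete.
Context {R : realType} {E : completeNormedModType R}.
Local Notation mu := (@lebesgue_measure R).
Variables (p : \bar R) (T : R).
Hypotheses (p1 : (1 <= p)%E) (T0 : 0 < T).
Local Open Scope ereal_scope.

Lemma LpnormE_triangle_ae (f g h : R -> E) :
  strongly_measurable_on 0 T f -> strongly_measurable_on 0 T g ->
  strongly_measurable_on 0 T h ->
  LpnormE p 0 T (fun x => f x - h x)%R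
    <= LpnormE p 0 T (fun x => f x - g x)%R + LpnormE p 0 T (fun x => g x - h x)%R.
Proof.
move=> /strongly_measurable_simple_limit[f' nf ff'].
move=> /strongly_measurable_simple_limit[g' ng gg'].
move=> /strongly_measurable_simple_limit[h' nh hh'].
rewrite (ae_eq_LpnormE p _ _ _ (fun x => f' x - h' x)%R) //; last 2 first.
- exact: simple_limitB.
- by apply: filterS2 ff' hh' => x fx hx xT; rewrite fx ?hx.
rewrite (ae_eq_LpnormE p _ _ (fun x => f x - g x)%R
  (fun x => f' x - g' x)%R) //; last 2 first.
- exact: simple_limitB.
- by apply: filterS2 ff' gg' => x fx hx xT; rewrite fx ?hx.
rewrite (ae_eq_LpnormE p _ _ (fun x => g x - h x)%R
  (fun x => g' x - h' x)%R) //; last 2 first.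
- exact: simple_limitB.
- by apply: filterS2 gg' hh' => x fx hx xT; rewrite fx ?hx.
exact: LpnormE_triangle.
Qed.

(** y <= e + (e / theta_bound) theta(y) for every y >= 0. *)
Lemma L1_le_LpnormE (e : R) (f : R -> E) : (0 < e)%R -> simple_limit f ->
  LpnormE p 0 T f <= e%:E ->
  \int[mu]_x (normr_on 0 T f x)%:E <= (e * (T + 1))%:E.
Proof.
move=> e0 nf fe; pose c := theta_bound R p e.
have c0 : (0 < c)%R by exact: theta_bound_gt0.
have mf := measurable_normr_on 0 T f nf.
have ec0 : (0 <= e / c)%R by rewrite divr_ge0// ltW.
have It : \int[mu]_x theta R p e (normr_on 0 T f x) <= c%:E.
  by apply: theta_le_Lnorm => // x; exact: normr_on_ge0.
have mt : measurable_fun setT (fun x => theta R p e (normr_on 0 T f x)).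
  exact: (measurableT_comp (measurable_theta _ _ _)).
apply: (@le_trans _ _ (\int[mu]_x ((if x \in `[0%R, T] then e%:E else 0) +
    (e / c)%:E * theta R p e (normr_on 0 T f x)))).
  apply: ge0_integral_mono => x; first by rewrite lee_fin normr_on_ge0.
  rewrite /normr_on; case: ifP => _; last by rewrite theta0// mule0 adde0.
  rewrite /theta /c /theta_bound; case: p p1 => [r||]//; last first.
    move=> _; case: (leP `|f x|%R e) => [xe|_]; first by rewrite mule0 adde0 lee_fin.
    by rewrite divr1 gt0_muley ?lte_fin// addey// leey.
  rewrite lee_fin => r1; rewrite -EFinM -EFinD lee_fin.
  have [fxe|/ltW efx] := leP `|f x|%R e.
    by rewrite ler_wpDr// mulr_ge0 ?powR_ge0// divr_ge0 ?powR_ge0// ltW.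
  have -> : `|f x|%R = (e * (`|f x| / e))%R by rewrite mulrC divfK// gt_eqF.
  rewrite ler_wpDl// ?(ltW e0)// -mulrA ler_pM2l//.
  rewrite [X in (_ <= X)%R]mulrC powRM ?(ltW e0) ?divr_ge0 ?(ltW e0)//.
  rewrite [X in (_ <= X / _)%R]mulrC mulfK ?gt_eqF ?powR_gt0//.
  by rewrite le1r_powR// ler_pdivlMr// mul1r.
rewrite ge0_integralD//; last 4 first.
- by move=> x _; case: ifP; rewrite ?lee_fin// ltW.
- by apply: measurable_fun_ifT => //; exact: measurable_fun_in_itv.
- by move=> x _; rewrite mule_ge0// theta_ge0.
- exact: measurable_funeM.
rewrite ge0_integralZl_EFin//; last by move=> x _; exact: theta_ge0.
rewrite mulrDr mulr1 EFinD; apply: leeD.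
  have muT : mu `[0%R, T] = T%:E.
    by rewrite lebesgue_measure_itv/= lte_fin T0 oppr0 adde0.
  rewrite (_ : (fun x => _) = (fun=> e%:E) \_ (`[0%R, T]%classic : set R)).
    by rewrite -integral_mkcond integral_cst// EFinM -muT.
  by apply/funext => x; rewrite patchE mem_setE.
apply: (@le_trans _ _ ((e / c)%:E * c%:E)); first by rewrite lee_wpmul2l.
by rewrite -EFinM divfK// gt_eqF.
Qed.

Lemma LpnormE_fatou (e : R) (g : nat -> R -> E) (f w : R -> E) : (0 < e)%R ->
  simple_limit f -> (forall k, simple_limit (g k)) -> simple_limit w ->
  {ae mu, forall x, x \in `[0%R, T] -> g k x @[k --> \oo] --> w x} ->
  (\forall k \near \oo, LpnormE p 0 T (fun x => f x - g k x)%R <= e%:E) ->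
  LpnormE p 0 T (fun x => f x - w x)%R <= e%:E.
Proof.
move=> e0 nf ng nw gw near_e; rewrite LpnormE_normr_on.
apply: (@Lnorm_fatou _ _ _ p1 e0 (fun k => normr_on 0 T (fun x => f x - g k x)%R)) => //.
- by move=> k; apply: measurable_normr_on; exact: simple_limitB.
- by apply: measurable_normr_on; exact: simple_limitB.
- by move=> k x; exact: normr_on_ge0.
- by move=> x; exact: normr_on_ge0.
apply: filterS gw => x gwx; rewrite /normr_on; case: ifPn => [xT|_]; last exact: cvg_cst.
by apply: cvg_norm; apply: cvgB; [exact: cvg_cst|exact: gwx].
Qed.

(** On the finite interval the increments are also summable in L^1, for every p. The series of their
    norms is therefore finite almost everywhere, and absolute convergence in the complete space [E]
    concludes. *)
Lemma ae_cvg_of_summable (g : nat -> R -> E) : (forall k, simple_limit (g k)) ->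
  (forall k, LpnormE p 0 T (fun x => g k.+1 x - g k x)%R <= ((2^-1) ^+ k)%:E) ->
  {ae mu, forall x, x \in `[0%R, T] -> cvgn (g ^~ x)}.
Proof.
move=> ng gS; pose D k := normr_on 0 T (fun x => g k.+1 x - g k x)%R.
have mD k : measurable_fun setT (EFin \o D k).
  by apply/measurable_EFinP; apply: measurable_normr_on; exact: simple_limitB.
have D0 k x : 0 <= (D k x)%:E by rewrite lee_fin normr_on_ge0.
have ID k : \int[mu]_x (D k x)%:E <= ((2^-1) ^+ k * (T + 1))%:E.
  by apply: L1_le_LpnormE; [rewrite exprn_gt0|exact: simple_limitB|exact: gS].
have Isum : \int[mu]_x (\sum_(0 <= k <oo) (D k x)%:E) < +oo.
  rewrite integral_nneseries//.
  apply: (@le_lt_trans _ _ (\sum_(0 <= k <oo) ((2^-1) ^+ k * (T + 1))%:E)).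
    by apply: lee_nneseries => [*|k *]; [exact: integral_ge0|exact: ID].
  apply: (@le_lt_trans _ _ (2 * (T + 1))%:E); last exact: ltry.
  (* The term (T + 1) / 2^k is written as 2 (T + 1) / 2^(k+1), the form summed by
     [epsilon_trick0]. *)
  apply: le_trans (epsilon_trick0 xpredT _); last by rewrite mulr_ge0// ltW// addr_gt0.
  apply: lee_nneseries => [k *|k *].
    by rewrite lee_fin mulr_ge0 ?exprn_ge0// ltW// addr_gt0.
  by rewrite lee_fin natrX exprS invfM mulrACA mulfV// mul1r mulrC exprVn.
have msum : measurable_fun setT (fun x => \sum_(0 <= k <oo) (D k x)%:E).
  by apply: ge0_emeasurable_sum => k *; [exact: D0|exact: mD].
have /integrable_ae : mu.-integrable setT (fun x => \sum_(0 <= k <oo) (D k x)%:E).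
  apply/integrableP; split => //.
  apply: le_lt_trans Isum; apply: ge0_integral_mono => x; first exact: abse_ge0.
  by rewrite gee0_abs//; apply: nneseries_ge0 => *; exact: D0.
move=> /(_ measurableT); apply: filterS => x /(_ Logic.I) fin xT.
have -> : g ^~ x = (fun n => (series (telescope (g ^~ x)) n + g 0%N x)%R).
  by apply/funext => n; rewrite [LHS](eq_sum_telescope (g ^~ x)) addrC.
apply: is_cvgD; last exact: is_cvg_cst.
apply: normed_cvg; apply: nondecreasing_is_cvgn.
  by apply: nondecreasing_series => k _ _; exact: normr_ge0.
exists (fine (\sum_(0 <= k <oo) (D k x)%:E)) => _ [n _ <-].
rewrite -lee_fin fineK//.
apply: le_trans (nneseries_lim_ge n _); last by move=> k _ _; exact: D0.
rewrite /normed_series_of seriesEnat /= -sumEFin; apply: lee_sum => k _.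
by rewrite /D /normr_on xT.
Qed.

End Complete.

(** * Relative compactness in Lp *)

Section RelCompactLp.
Context {R : realType} {E1 E2 : completeNormedModType R}.
Local Notation mu := (@lebesgue_measure R).
Variables (T : R) (p : \bar R) (B : E1 -> E2) (U : set (R -> E1)).
Hypotheses (T0 : 0 < T) (p1 : (1 <= p)%E) (cB : compact_operator B).
Hypothesis U_L1 : forall u, U u -> in_Lp 1%E 0 T u.
Hypothesis U_bounded : exists M : R, forall u, U u -> (LpnormE 1%E 0 T u <= M%:E)%E.
Hypothesis V_Lp : forall u, U u -> in_Lp p 0 T (B \o u).
Hypothesis V_trans : forall eps : R, 0 < eps -> exists delta : R, 0 < delta /\
  forall h : R, 0 < h < delta -> forall u, U u ->
    (LpnormE p 0 (T - h) (fun x => ((B \o u) (x + h) - (B \o u) x)%R) <= eps%:E)%E.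

(** The order of quantifiers matters: [n] and [K] are chosen before [u], so one compact set contains
    all step values. Taking eps / 4 absorbs the factor 4 of [sampling]. *)
Lemma step_approximation (eps : R) : 0 < eps -> exists (n : nat) (K : R),
  forall u, U u -> exists b : nat -> E1, (forall k, (k <= n)%N -> `|b k| <= K) /\
    (LpnormE p 0 T (fun x => B (u x) - B (b (cell R T n x)))%R <= eps%:E)%E.
Proof.
move=> eps0; have eps4 : 0 < eps / 4 by rewrite divr_gt0.
have [delta [delta0 trans]] := V_trans _ eps4.
have [M UM] := U_bounded; pose M' := Num.max M 0.
have M'0 : 0 <= M' by rewrite le_max lexx orbT.
(* Makes T / (n+1) smaller than delta, so that every translation within a cell width is
   admissible. *)
pose n := Num.truncn (T / delta); exists n.
exists (4 * n.+1%:R * (M' + 1) / cell_width R T n) => u Uu.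
have hd : cell_width R T n < delta.
  rewrite /cell_width ltr_pdivrMr// mulrC -ltr_pdivrMr//.
  by have /andP[] := truncn_itv (divr_ge0 (ltW T0) (ltW delta0)).
have [|h /andP[h0 hh]|a [aK aP]] :=
    sampling p (eps / 4) T M' n u (B \o u) p1 eps4 T0 M'0 (U_L1 _ Uu).1 _ (V_Lp _ Uu).1.
- by apply: le_trans (UM _ Uu) _; rewrite lee_fin le_max lexx.
- by apply: trans => //; rewrite h0 (lt_trans hh).
- exists (u \o a); split => //.
  by move: aP; rewrite mulrC divfK// pnatr_eq0.
Qed.

(** An index is colored by the word of colors of its n+1 step values. Equal words give close step
    functions, and eps / 3 is spent on each of the two approximations and on their comparison. *)
Lemma Lp_coloring (u : nat -> R -> E1) (eps : R) : (forall i, U (u i)) -> 0 < eps ->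
  exists (F : finType) (col : nat -> F), forall i j, col i = col j ->
    (LpnormE p 0 T (fun x => B (u i x) - B (u j x))%R <= eps%:E)%E.
Proof.
move=> Uu eps0; have eps3 : 0 < eps / 3 by rewrite divr_gt0.
have [n [K approx]] := step_approximation _ eps3.
have /choice[b bP] := fun i => approx (u i) (Uu i).
pose A := [set x : E1 | `|x| <= K].
have bA : bounded_set A.
  by exists K; split; [exact: num_real|move=> M KM x /= /le_trans; apply; exact: ltW].
have eta0 : 0 < eps / 3 / (T + 1) by rewrite divr_gt0// addr_gt0.
have [m [col colP]] := compact_coloring R E2 _ _ (cB A bA) eta0.
exists {ffun 'I_n.+1 -> 'I_m}, (fun i => [ffun k : 'I_n.+1 => col (B (b i k))]).
move=> i j /ffunP ij.
pose g i x := B (b i (cell R T n x)).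
have sg i' : simple_function (g i').
  exact: (simple_function_cell R T n T0 _ (fun k => B (b i' k))).
have smg i' : strongly_measurable_on 0 T (g i').
  by apply: simple_limit_strongly_measurable; exact: simple_function_limit.
have smv i' : strongly_measurable_on 0 T (B \o u i') := (V_Lp _ (Uu i')).1.
have gij : (LpnormE p 0 T (fun x => g i x - g j x)%R <= (eps / 3)%:E)%E.
  rewrite LpnormE_normr_on; apply: (Lnorm_bounded _ _ _ p1 eps3 T) => //.
  - by apply: measurable_normr_on; apply: simple_limitB; exact: simple_function_limit.
  - by move=> x; exact: normr_on_ge0.
  move=> x; rewrite /normr_on; case: ifP => // _.
  have ck : (cell R T n x < n.+1)%N by rewrite ltnS cell_le.
  have clA i' : closure (B @` A) (g i' x).
    by apply: subset_closure; exists (b i' (cell R T n x)) => //; apply: (bP i').1.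
  apply: colP => //; have := ij (Ordinal ck); rewrite !ffunE => ->//.
apply: (le_trans (LpnormE_triangle_ae p T p1 (B \o u i) (g i) (B \o u j) _ _ _)) => //.
apply: (@le_trans _ _ ((eps / 3)%:E + ((eps / 3)%:E + (eps / 3)%:E))%E).
  apply: leeD; first exact: (bP i).2.
  apply: (le_trans (LpnormE_triangle_ae p T p1 (g i) (g j) (B \o u j) _ _ _)) => //.
  apply: leeD => //; rewrite LpnormEB; exact: (bP j).2.
by rewrite -!EFinD lee_fin; lra.
Qed.

Lemma rel_compact_Lp_image : rel_compact_Lp p T [set B \o u | u in U].
Proof.
move=> v /= Vv.
have /choice[u uP] : forall i, exists u, U u /\ B \o u = v i.
  by move=> i; have [u Uu <-] := Vv i; exists u.
have Uu i := (uP i).1; have {uP} vu i : v i = B \o u i by rewrite (uP i).2.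
pose e k : R := 2^-1 ^+ k / 3.
have e0 k : 0 < e k by rewrite divr_gt0// exprn_gt0.
have e_half k : e k.+1 = e k / 2 by rewrite /e exprS; lra.
have e_le k l : (k <= l)%N -> e l <= e k.
  move=> /subnK <-; elim: (l - k)%N => // m; apply: le_trans.
  by rewrite addSn e_half; have := e0 (m + k)%N; lra.
have [phi [phi_incr phiP]] := diagonal_subsequence
  (fun k i j => LpnormE p 0 T (fun x => B (u i x) - B (u j x))%R <= (e k.+1)%:E)%E
  (fun k => Lp_coloring u _ Uu (e0 k.+1)).
(* The limit is built from step functions rather than from the [v (phi k)]: being simple, they
   witness the strong measurability of their almost everywhere limit directly. *)
have /choice[g gP] : forall k, exists g : R -> E2, simple_function g /\
    (LpnormE p 0 T (fun x => B (u (phi k) x) - g x)%R <= (e k.+2)%:E)%E.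
  move=> k; have [n [K approx]] := step_approximation _ (e0 k.+2).
  have [b [_ bP]] := approx _ (Uu (phi k)).
  exists (fun x => B (b (cell R T n x))); split => //.
  exact: (simple_function_cell R T n T0 _ (fun k => B (b k))).
have ng k : simple_limit (g k) by apply: simple_function_limit; exact: (gP k).1.
have smg k : strongly_measurable_on 0 T (g k) by exact: simple_limit_strongly_measurable.
have smv i : strongly_measurable_on 0 T (B \o u i) := (V_Lp _ (Uu i)).1.
have gkl k l : (k <= l)%N -> (LpnormE p 0 T (fun x => g k x - g l x)%R <= (e k)%:E)%E.
  move=> kl.
  apply: (le_trans (LpnormE_triangle_ae p T p1 (g k) (B \o u (phi k)) (g l) _ _ _)) => //.
  apply: (@le_trans _ _ ((e k.+2)%:E + ((e k.+1)%:E + (e k.+2)%:E))%E).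
    apply: leeD; first by rewrite LpnormEB; exact: (gP k).2.
    apply: (le_trans (LpnormE_triangle_ae p T p1 (B \o u (phi k))
      (B \o u (phi l)) (g l) _ _ _)) => //.
    apply: leeD; first exact: phiP.
    by apply: le_trans (gP l).2 _; rewrite lee_fin e_le.
  by rewrite -!EFinD lee_fin !e_half; lra.
have g_cvg : {ae mu, forall x, x \in `[0, T] -> cvgn (g ^~ x)}.
  apply: (ae_cvg_of_summable p T p1 T0) => // k.
  rewrite LpnormEB; apply: le_trans (gkl k k.+1 (leqnSn k)) _.
  rewrite lee_fin /e ler_pdivrMr// ler_peMr ?exprn_ge0//; lra.
pose w x := limn (g ^~ x).
have gw : {ae mu, forall x, x \in `[0, T] -> g n x @[n --> \oo] --> w x}.
  by apply: filterS g_cvg => x gx xT; exact: gx.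
have smw : strongly_measurable_on 0 T w.
  by exists g; split => // k; exact: (gP k).1.
have [w' nw' ww'] := strongly_measurable_simple_limit _ _ _ smw.
have gkw k : (LpnormE p 0 T (fun x => g k x - w x)%R <= (e k)%:E)%E.
  rewrite (ae_eq_LpnormE p _ _ _ (fun x => g k x - w' x)%R) //; last 2 first.
  - exact: simple_limitB.
  - by apply: filterS ww' => x + xT => ->.
  apply: (LpnormE_fatou p T p1 (e k) g) => //.
    by apply: filterS2 gw ww' => x gwx + xT => ->//; exact: gwx.
  by exists k => // l /= kl; exact: gkl.
have vkw k : (LpnormE p 0 T (fun x => B (u (phi k) x) - w x)%R <= (2^-1 ^+ k)%:E)%E.
  apply: (le_trans (LpnormE_triangle_ae p T p1 (B \o u (phi k)) (g k) w _ _ _)) => //.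
  apply: (le_trans (leeD (gP k).2 (gkw k))); rewrite -EFinD lee_fin !e_half /e.
  by have : (0 : R) < 2^-1 ^+ k by [rewrite exprn_gt0]; lra.
exists phi, w; split => //; split; first split => //.
  pose z : R -> E2 := fun=> 0.
  have smz : strongly_measurable_on 0 T z.
    apply: simple_limit_strongly_measurable.
    by apply: simple_function_limit; exact: simple_function_cst.
  rewrite (_ : w = fun x => w x - z x)%R; last by apply/funext => x; rewrite subr0.
  apply: (le_lt_trans (LpnormE_triangle_ae p T p1 w (B \o u (phi 0%N)) z _ _ _)) => //.
  apply: lte_add_pinfty; first by rewrite LpnormEB; apply: le_lt_trans (vkw 0%N) (ltry _).
  rewrite (_ : (fun x => _) = B \o u (phi 0%N)).
    exact: (V_Lp _ (Uu _)).2.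
  by apply/funext => x; rewrite subr0.
apply: (@squeeze_cvge _ _ _ _ (fun=> 0%E) _ (fun k => (2^-1 ^+ k)%:E)).
- apply: nearW => k; rewrite vu vkw andbT; exact: Lnorm_ge0.
- exact: cvg_cst.
- apply/fine_cvgP; split; first exact: nearW.
  by apply: cvg_expr; rewrite ger0_norm ?invr_ge0// invf_lt1 ?ltr1n.
Qed.

End RelCompactLp.

(** * Continuous representatives *)

Section AePoints.
Variable R : realType.
Local Notation mu := (@lebesgue_measure R).

Lemma ae_and (P Q : R -> Prop) : {ae mu, forall x, P x} ->
  {ae mu, forall x, Q x} -> {ae mu, forall x, P x /\ Q x}.
Proof. by move=> aeP aeQ; apply: filterS2 aeP aeQ. Qed.

Lemma ae_exists_itv (P : R -> Prop) (a b : R) : a < b ->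
  {ae mu, forall x, P x} -> exists2 t, a < t < b & P t.
Proof.
move=> ab [N [mN N0 PN]]; apply: contrapT => noP.
have abN : `]a, b[%classic `<=` N.
  move=> t; rewrite /= in_itv/= => tab; apply: PN => Pt; apply: noP.
  by exists t.
have : (mu `]a, b[%classic <= mu N)%E by apply: le_measure; rewrite ?inE.
rewrite N0 lebesgue_measure_itv/= lte_fin ab -EFinB lee_fin.
by rewrite leNgt subr_gt0 ab.
Qed.

Lemma ae_near_right (P Q : R -> Prop) : {ae mu, forall x, P x} ->
  (\forall e \near 0^'+, Q e) -> exists e, [/\ 0 < e, P e & Q e].
Proof.
move=> aeP [d /= d0 dQ]; have [e /andP[e0 ed] Pe] := ae_exists_itv P 0 d d0 aeP.
by exists e; split => //; apply: dQ => //=; rewrite sub0r normrN gtr0_norm.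
Qed.

Lemma cell_right_shift (T : R) n x : 0 < T -> 0 <= x ->
  \forall e \near 0^'+, cell R T n (e + x) = cell R T n x.
Proof.
move=> T0 x0; have := cell_right R T n T0 x x0.
by move/nbhs_right0P; apply: filterS => e; rewrite addrC.
Qed.

(** The cells of x in the two grids share a nontrivial interval to the right of x, or to the left of
    T if x = T, and no null set contains it. This is how two step functions are compared at every
    point. *)
Lemma ae_same_cells (T : R) (n m : nat) (x : R) (P : R -> Prop) : 0 < T ->
  x \in `[0, T] -> {ae mu, forall t, P t} ->
  exists t, [/\ t \in `[0, T], P t, cell R T n t = cell R T n x &
    cell R T m t = cell R T m x].
Proof.
move=> T0; rewrite in_itv/= => /andP[x0]; rewrite le_eqVlt => /predU1P[->|xT] aeP.
  have lastT k : k%:R * cell_width R T k < T.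
    rewrite -[ltRHS](cell_width_mul R T k) ltr_pM2r ?cell_width_gt0// ltr_nat.
    exact: ltnSn.
  have [|t /andP[]] := ae_exists_itv P
      (Num.max (n%:R * cell_width R T n) (m%:R * cell_width R T m)) T _ aeP.
    by rewrite gt_max !lastT.
  rewrite gt_max => /andP[nt mt] tT Pt; exists t; split => //.
  - rewrite in_itv/= (ltW tT) andbT (le_trans _ (ltW nt))//.
    by rewrite mulr_ge0// ltW// cell_width_gt0.
  - by rewrite !cell_last// ltW.
  - by rewrite !cell_last// ltW.
have [|e [e0 Pe [en em eT]]] := ae_near_right (fun e => P (e + x)) (fun e =>
    [/\ cell R T n (e + x) = cell R T n x, cell R T m (e + x) = cell R T m x &
      e < T - x]) (ae_shift R x P aeP).
  near=> e; split; last by near: e; apply: nbhs_right_lt; rewrite subr_gt0.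
    by near: e; exact: cell_right_shift.
  by near: e; exact: cell_right_shift.
exists (e + x); split => //; rewrite in_itv/=; apply/andP; split; lra.
Unshelve. all: by end_near. Qed.

End AePoints.

Section UniformLimits.
Context {R : realType} {E : completeNormedModType R}.
Local Notation mu := (@lebesgue_measure R).

Lemma cauchy_seq_cvgn (a : nat -> E) :
  (forall eps : R, 0 < eps -> exists N, forall n m, (N <= n)%N -> (N <= m)%N ->
    `|a n - a m| <= eps) -> cvgn a.
Proof.
move=> ca; apply: cauchy_cvg; apply: cauchy_exP => eps eps0.
have [N NP] := ca (eps / 2) (divr_gt0 eps0 (ltr0Sn _ 1)).
exists (a N); exists N => // n /= Nn; rewrite -ball_normE /=.
by rewrite (le_lt_trans (NP N n _ _))// ltr_pdivrMr// ltr_pMr// ltr1n.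
Qed.

Lemma dist_limn_le (a : nat -> E) (y : E) (eps : R) N : cvgn a ->
  (forall n, (N <= n)%N -> `|y - a n| <= eps) -> `|y - limn a| <= eps.
Proof.
move=> ca aN.
have c : `|y - a n| @[n --> \oo] --> `|y - limn a|.
  by apply: cvg_norm; apply: cvgB; [exact: cvg_cst|exact: ca].
rewrite -(cvg_lim _ c)//; apply: limr_le; first by apply/cvg_ex; exists `|y - limn a|.
by exists N.
Qed.

Lemma within_continuousP (T : R) (w : R -> E) :
  (forall eps : R, 0 < eps -> forall x, x \in `[0, T] -> exists2 d, 0 < d &
    forall y, y \in `[0, T] -> `|x - y| < d -> `|w x - w y| <= eps) <->
  {within `[0, T], continuous w}.
Proof.
split => [H|/subspace_continuousP wc eps eps0 x xT].
  apply/subspace_continuousP => x xT; apply/cvgrPdist_le => eps eps0.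
  have [d d0 dP] := H eps eps0 x xT.
  by exists d => // y /= xy yT; exact: dP.
have := wc x xT; move/cvgrPdist_le => /(_ eps eps0) [d /= d0 dP].
by exists d => // y yT xy; exact: dP.
Qed.

(** Points satisfying the bound accumulate at each x of [0,T], endpoints included, since a null set
    contains no interval. *)
Lemma continuous_ae_dist_le (T e : R) (w z : R -> E) : 0 < T ->
  {within `[0, T], continuous w} -> {within `[0, T], continuous z} ->
  {ae mu, forall x, x \in `[0, T] -> `|w x - z x| <= e} ->
  forall x, x \in `[0, T] -> `|w x - z x| <= e.
Proof.
move=> T0 /within_continuousP wc /within_continuousP zc aele x xT.
apply/ler_addgt0Pr => eps eps0; have eps2 : 0 < eps / 2 by rewrite divr_gt0.
have [d d0 dw] := wc _ eps2 x xT; have [d' d'0 dz] := zc _ eps2 x xT.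
pose a := Num.max 0 (Num.max (x - d) (x - d')).
pose b := Num.min T (Num.min (x + d) (x + d')).
have /andP[x0 xT'] : 0 <= x <= T by move: xT; rewrite in_itv.
have [|t /andP[]] := ae_exists_itv R _ a b _ aele.
  rewrite /a /b !gt_max !lt_min.
  by do ![apply/andP; split]; lra.
rewrite /a /b !gt_max !lt_min => /and3P[t0 td td'] /and3P[tT td2 td2'].
have tT' : t \in `[0, T] by rewrite in_itv/= !ltW.
move=> /(_ tT') wzt.
have wxt : `|w x - w t| <= eps / 2.
  by apply: dw => //; rewrite ltr_norml; apply/andP; split; lra.
have zxt : `|z x - z t| <= eps / 2.
  by apply: dz => //; rewrite ltr_norml; apply/andP; split; lra.
rewrite -(subrKA (w t)) (le_trans (ler_normD _ _))//.
rewrite -(subrKA (z t) (w t)) (le_trans (lerD wxt (ler_normD _ _)))//.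
by rewrite [X in _ + (_ + X)]distrC; lra.
Qed.

Lemma uniform_limit_within_continuous (T : R) (w : nat -> R -> E) (z : R -> E) :
  (forall n, {within `[0, T], continuous (w n)}) ->
  (forall eps : R, 0 < eps -> exists n, forall x, x \in `[0, T] ->
    `|w n x - z x| <= eps) -> {within `[0, T], continuous z}.
Proof.
move=> wc wz; apply/within_continuousP => eps eps0 x xT.
have eps3 : 0 < eps / 3 by rewrite divr_gt0.
have [n nz] := wz _ eps3; have /within_continuousP/(_ _ eps3 x xT)[d d0 dP] := wc n.
exists d => // y yT xy; rewrite -(subrKA (w n x)) (le_trans (ler_normD _ _))//.
rewrite -(subrKA (w n y) (w n x)).
apply: (le_trans (lerD (lexx _) (ler_normD _ _))).
have := nz x xT; have := nz y yT; have := dP y yT xy.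
rewrite distrC [`|w n x - z x|]distrC.
by rewrite (distrC (w n y)); lra.
Qed.

Lemma LpnormEy_ae_le (a b e : R) (f : R -> E) : (LpnormE +oo a b f <= e%:E)%E ->
  {ae mu, forall x, x \in `[a, b] -> `|f x| <= e}.
Proof.
rewrite /LpnormE unlock ifT; last exact: lebesgue_measure_setT_gt0.
move=> /ess_supP; apply: filterS => x /= + xab.
by rewrite /norm_on xab /= normr_id lee_fin.
Qed.

End UniformLimits.

(** * Relative compactness in the space of continuous functions *)

Section RelCompactC.
Context {R : realType} {E1 E2 : completeNormedModType R}.
Local Notation mu := (@lebesgue_measure R).
Variables (T : R) (B : E1 -> E2) (U : set (R -> E1)).
Hypotheses (T0 : 0 < T) (cB : compact_operator B).
Hypothesis U_L1 : forall u, U u -> in_Lp 1%E 0 T u.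
Hypothesis U_bounded : exists M : R, forall u, U u -> (LpnormE 1%E 0 T u <= M%:E)%E.
Hypothesis V_Lp : forall u, U u -> in_Lp +oo%E 0 T (B \o u).
Hypothesis V_trans : forall eps : R, 0 < eps -> exists delta : R, 0 < delta /\
  forall h : R, 0 < h < delta -> forall u, U u ->
    (LpnormE +oo%E 0 (T - h) (fun x => ((B \o u) (x + h) - (B \o u) x)%R) <= eps%:E)%E.

Lemma ae_step_approximation (u : R -> E1) (eps : R) : U u -> 0 < eps ->
  exists (n : nat) (c : nat -> E2),
    {ae mu, forall x, x \in `[0, T] -> `|B (u x) - c (cell R T n x)| <= eps}.
Proof.
move=> Uu eps0.
have [n [K /(_ u Uu)[b [_ bP]]]] :=
  step_approximation T +oo%E B U T0 (leey 1%E) U_L1 U_bounded V_Lp V_trans eps eps0.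
by exists n, (fun k => B (b k)); exact: LpnormEy_ae_le bP.
Qed.

(** Both points are moved right by the same small s. This preserves their difference and, by right
    continuity, their cells, while s can be chosen so that all the almost everywhere estimates
    hold. *)
Lemma step_dist_lt (u : R -> E1) (n : nat) (c : nat -> E2) (e eps delta : R) :
  {ae mu, forall x, x \in `[0, T] -> `|B (u x) - c (cell R T n x)| <= e} ->
  (forall h : R, 0 < h < delta ->
    (LpnormE +oo%E 0 (T - h) (fun x => ((B \o u) (x + h) - (B \o u) x)%R) <= eps%:E)%E) ->
  forall x y, 0 <= x -> x < y -> y < T -> y - x < delta ->
  `|c (cell R T n x) - c (cell R T n y)| <= eps + 2 * e.
Proof.
move=> ae_c trans x y x0 xy yT yxd.
have y0 : 0 <= y by rewrite (le_trans x0)// ltW.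
have yx0 : 0 < y - x by rewrite subr_gt0.
have ae_t : {ae mu, forall t, t \in `[0, T - (y - x)] ->
    `|(B \o u) (t + (y - x)) - (B \o u) t| <= eps}.
  by apply: LpnormEy_ae_le; apply: trans; rewrite yx0.
have aeP := ae_and R _ _ (ae_shift R x _ ae_t)
  (ae_and R _ _ (ae_shift R x _ ae_c) (ae_shift R y _ ae_c)).
have [|s [s0 [Ps [Psx Psy]] [sT sx sy]]] := ae_near_right R _ (fun e =>
    [/\ e < T - y, cell R T n (e + x) = cell R T n x &
      cell R T n (e + y) = cell R T n y]) aeP.
  near=> t; split; first by near: t; apply: nbhs_right_lt; rewrite subr_gt0.
    by near: t; exact: cell_right_shift.
  by near: t; exact: cell_right_shift.
have sxT : s + x \in `[0, T] by rewrite in_itv/=; apply/andP; split; lra.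
have syT : s + y \in `[0, T] by rewrite in_itv/=; apply/andP; split; lra.
have sxyT : s + x \in `[0, T - (y - x)] by rewrite in_itv/=; apply/andP; split; lra.
have := Ps sxyT; have := Psx sxT; have := Psy syT; rewrite /= sx sy.
rewrite (_ : s + x + (y - x) = s + y); last by lra.
set vx := B (u (s + x)); set vy := B (u (s + y)) => vyc vxc vyx.
rewrite -(subrKA vx) (le_trans (ler_normD _ _))//.
rewrite -(subrKA vy vx) (le_trans (lerD (lexx _) (ler_normD _ _)))//.
rewrite distrC [X in _ + (X + _)]distrC; lra.
Unshelve. all: by end_near. Qed.

(** At y = T there is no room on the right, so T is replaced by an earlier point of the last cell
    that still lies beyond x. *)
Lemma step_dist_le (u : R -> E1) (n : nat) (c : nat -> E2) (e eps delta : R) :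
  {ae mu, forall x, x \in `[0, T] -> `|B (u x) - c (cell R T n x)| <= e} ->
  (forall h : R, 0 < h < delta ->
    (LpnormE +oo%E 0 (T - h) (fun x => ((B \o u) (x + h) - (B \o u) x)%R) <= eps%:E)%E) ->
  forall x y, 0 <= x -> x < y -> y <= T -> y - x < delta ->
  `|c (cell R T n x) - c (cell R T n y)| <= eps + 2 * e.
Proof.
move=> ae_c trans x y x0 xy; rewrite le_eqVlt => /predU1P[yT xyd|yT].
  rewrite {}yT in xy xyd *; pose z := Num.max x (n%:R * cell_width R T n).
  have nT : n%:R * cell_width R T n < T.
    rewrite -[ltRHS](cell_width_mul R T n) ltr_pM2r ?cell_width_gt0// ltr_nat.
    exact: ltnSn.
  have zT : z < T by rewrite gt_max xy.
  have xz : x <= z by rewrite le_max lexx.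
  have nz : n%:R * cell_width R T n <= z by rewrite le_max lexx orbT.
  have -> : cell R T n T = cell R T n ((z + T) / 2).
    by rewrite !cell_last//; lra.
  by apply: (step_dist_lt u n c e eps delta) => //; lra.
exact: (step_dist_lt u n c e eps delta).
Qed.

Lemma half_expr_le (eps : R) : 0 < eps -> exists k, 2^-1 ^+ k <= eps.
Proof.
move=> eps0; have : 2^-1 ^+ k @[k --> \oo] --> (0 : R).
  by apply: cvg_expr; rewrite ger0_norm ?invr_ge0// invf_lt1 ?ltr1n.
move=> /cvgrPdist_le /(_ eps eps0) [k _ /(_ k (leqnn k))].
rewrite sub0r normrN ger0_norm; first by exists k.
by rewrite exprn_ge0.
Qed.

(** The step functions [g k] are discontinuous, but their oscillation at small distances is
    controlled by [step_dist_le]. It tends to 0 along with their uniform error, so the limit is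
    continuous. *)
Lemma continuous_representative (u : R -> E1) : U u ->
  exists w, cont_repr T (B \o u) w.
Proof.
move=> Uu; pose e k : R := 2^-1 ^+ k.
have e0 k : 0 < e k by rewrite exprn_gt0.
have e_le k l : (k <= l)%N -> e l <= e k.
  by move=> kl; apply: ler_wiXn2l => //; rewrite invf_le1 ?ler1n.
have /choice[nc ncP] : forall k, exists nc : nat * (nat -> E2),
    {ae mu, forall x, x \in `[0, T] ->
      `|B (u x) - nc.2 (cell R T nc.1 x)| <= e k}.
  by move=> k; have [n [c nP]] := ae_step_approximation u _ Uu (e0 k); exists (n, c).
pose g k x := (nc k).2 (cell R T (nc k).1 x).
have gkl k l x : x \in `[0, T] -> `|g k x - g l x| <= e k + e l.
  move=> xT; have [t [tT [Pk Pl] cn cm]] := ae_same_cells R T (nc k).1 (nc l).1 x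
    _ T0 xT (ae_and R _ _ (ncP k) (ncP l)).
  have := Pk tT; have := Pl tT; rewrite /g cn cm => Bl Bk.
  rewrite -(subrKA (B (u t))) (le_trans (ler_normD _ _))//.
  by rewrite lerD// distrC.
have g_cvg x : x \in `[0, T] -> cvgn (g ^~ x).
  move=> xT; apply: cauchy_seq_cvgn => eps eps0.
  have [N Ne] := half_expr_le (eps / 2) (divr_gt0 eps0 (ltr0Sn _ 1)).
  exists N => n m Nn Nm; apply: (le_trans (gkl n m x xT)).
  have := e_le _ _ Nn; have := e_le _ _ Nm; rewrite /e in Ne *; lra.
pose w x := limn (g ^~ x).
have gw k x : x \in `[0, T] -> `|g k x - w x| <= 2 * e k.
  move=> xT; apply: (dist_limn_le _ _ _ k (g_cvg x xT)) => l kl.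
  by apply: (le_trans (gkl k l x xT)); have := e_le _ _ kl; lra.
exists w; split.
  apply/within_continuousP => eps eps0.
  (* Two errors 2 [e k] and the oscillation eps / 7 + 2 [e k] add up to at most seven times eps /
     7. *)
  have eps7 : 0 < eps / 7 by rewrite divr_gt0.
  have [delta [delta0 trans]] := V_trans _ eps7.
  have [k ke] := half_expr_le _ eps7; rewrite -/(e k) in ke.
  have wxy x y : x \in `[0, T] -> y \in `[0, T] -> x < y -> y - x < delta ->
      `|w x - w y| <= eps.
    move=> xT yT xy xyd; rewrite -(subrKA (g k x)) (le_trans (ler_normD _ _))//.
    rewrite -(subrKA (g k y) (g k x)).
    apply: (le_trans (lerD (lexx _) (ler_normD _ _))).
    have := gw k x xT; have := gw k y yT.
    have : `|g k x - g k y| <= eps / 7 + 2 * e k.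
      move: xT yT; rewrite !in_itv/= => /andP[x0 _] /andP[_ yT].
      apply: (step_dist_le u (nc k).1 (nc k).2 (e k) _ delta (ncP k)) => // h h0.
      exact: trans.
    by rewrite (distrC (w x)); lra.
  move=> x xT; exists delta => // y yT.
  have [xy|yx|->] := ltgtP x y.
  - by rewrite ltr0_norm ?subr_lt0// opprB; exact: wxy.
  - by rewrite gtr0_norm ?subr_gt0// distrC; exact: wxy.
  - by move=> _; rewrite subrr normr0; exact: ltW.
have /ae_foralln := ncP; apply: filterS => x xP xT.
apply/eqP; rewrite -subr_eq0 -normr_le0; apply/ler_addgt0Pr => eps eps0.
have [k ke] := half_expr_le _ (divr_gt0 eps0 (ltr0Sn _ 2)).
rewrite add0r -(subrKA (g k x)) (le_trans (ler_normD _ _))//.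
have := gw k x xT; have := xP k xT; rewrite -/(g k x).
rewrite (distrC (w x)) (distrC (g k x) (B _)).
by rewrite -/(e k) in ke; lra.
Qed.

(** For continuous representatives an almost everywhere bound is a uniform one, so the subsequence
    converging in the essential supremum norm is uniformly Cauchy. Its limit [z] is determined only
    almost everywhere and is replaced by the pointwise limit [y] of the representatives. *)
Lemma rel_compact_C_image : rel_compact_C T [set B \o u | u in U].
Proof.
split=> [v [u Uu <-]|v w Vv vw]; first exact: continuous_representative.
have [phi [z [phi_incr [_ vz]]]] := rel_compact_Lp_image T +oo%E B U T0 (leey 1%E)
  cB U_L1 U_bounded V_Lp V_trans v Vv.
have w_cauchy (eps : R) : 0 < eps -> exists N, forall n m x, (N <= n)%N ->
    (N <= m)%N -> x \in `[0, T] -> `|w (phi n) x - w (phi m) x| <= eps.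
  move=> eps0; have eps2 : 0 < eps / 2 by rewrite divr_gt0.
  have [N _ NP] : \forall n \near \oo,
      (LpnormE +oo%E 0 T (fun x => v (phi n) x - z x)%R <= (eps / 2)%:E)%E.
    have /fine_cvgP[fin /cvgrPdist_le/(_ _ eps2) small] := vz.
    apply: filterS2 fin small => n fin_n; rewrite sub0r normrN => small_n.
    by rewrite -(fineK fin_n) lee_fin (le_trans (ler_norm _)).
  exists N => n m x Nn Nm; apply: continuous_ae_dist_le => //.
  - exact: (vw (phi n)).1.
  - exact: (vw (phi m)).1.
  have nz := LpnormEy_ae_le _ _ _ _ (NP n Nn).
  have mz := LpnormEy_ae_le _ _ _ _ (NP m Nm).
  apply: filterS2 (ae_and R _ _ nz mz) (ae_and R _ _ (vw (phi n)).2 (vw (phi m)).2).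
  move=> t [nzt mzt] [wnt wmt] tT; rewrite wnt// wmt//.
  rewrite -(subrKA (z t)) (le_trans (ler_normD _ _))// [X in _ + X]distrC.
  have := nzt tT; have := mzt tT; lra.
have w_cvg x : x \in `[0, T] -> cvgn (fun n => w (phi n) x).
  move=> xT; apply: cauchy_seq_cvgn => eps eps0.
  by have [N NP] := w_cauchy _ eps0; exists N => n m Nn Nm; exact: NP.
pose y x := limn (fun n => w (phi n) x).
have w_unif (eps : R) : 0 < eps -> exists N, forall n x, (N <= n)%N ->
    x \in `[0, T] -> `|w (phi n) x - y x| <= eps.
  move=> eps0; have [N NP] := w_cauchy _ eps0; exists N => n x Nn xT.
  by apply: (dist_limn_le _ _ _ N (w_cvg x xT)) => m Nm; exact: NP.
exists phi, y; split => //; split.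
  apply: (uniform_limit_within_continuous T (fun n => w (phi n))).
    by move=> n; exact: (vw (phi n)).1.
  move=> eps eps0; have [N NP] := w_unif _ eps0; exists N => x xT; exact: NP.
move=> eps eps0; have [N NP] := w_unif _ eps0.
by exists N => // n /= Nn x xT; exact: NP.
Qed.

End RelCompactC.

Theorem theorem1 (R : realType) (E1 E2 : completeNormedModType R)
  (T : R) (p r : \bar R) (B : E1 -> E2) (U : set (R -> E1)) :
  0 < T -> (1 <= p)%E -> (1 < r)%E ->
  compact_operator B ->
  (* U is a bounded subset of L^1(0,T;E1) *)
  (forall u, U u -> in_Lp 1%E 0 T u) ->
  (exists M : R, forall u, U u -> (LpnormE 1%E 0 T u <= M%:E)%E) ->
  (* V = B(U) is a subset of L^p(0,T;E2), bounded in L^r(0,T;E2) *)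
  (forall u, U u -> in_Lp p 0 T (B \o u)) ->
  (exists M : R, forall u, U u -> (LpnormE r 0 T (B \o u) <= M%:E)%E) ->
  (* uniform L^p-equicontinuity of translations *)
  (forall eps : R, 0 < eps -> exists delta : R, 0 < delta /\
     forall h : R, 0 < h < delta -> forall u, U u ->
       (LpnormE p 0 (T - h) (fun x => ((B \o u) (x + h) - (B \o u) x)%R) <= eps%:E)%E) ->
  rel_compact_Lp p T [set B \o u | u in U] /\
  (p = +oo%E -> rel_compact_C T [set B \o u | u in U]).
Proof.
move=> T0 p1 _ cB U_L1 U_bounded V_Lp _ V_trans; split.
  exact: rel_compact_Lp_image.
by move=> pE; subst p; exact: rel_compact_C_image.
Qed.
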